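(* Consider the ARRU described in the context with $m_1>m_2$. Assume there exist $0<\rho_{\min}\le\rho_{\max}<1$ and $c_\rho>0$ with $P(\rho_{\min}\le\hat\rho_{2,n}\le\hat\rho_{1,n}\le\rho_{\max})\ge1-\exp(-c_\rho n)$ for all large $n$, and constants $\rho_1\ge\rho_2$ in $(0,1)$ with $\hat\rho_{1,n}\to\rho_1$, $\hat\rho_{2,n}\to\rho_2$ in probability. Let $c_1>0$, $C_1<\infty$, $\epsilon_y>0$ be constants with $P(y_0+c_1n\le Y_n\le y_0+C_1n)\ge1-\exp(-\epsilon_yn)$ for all large $n$ (such constants exist under these assumptions). Let $\Delta_n=|\rho_1-Z_n|$, $Q(\delta,n)=\{\Delta_n>\delta\}$ and, for $\delta>0$, $s_\delta\in\big(0,\exp(\tfrac{c_1}{2b}\delta)-1\big)$. Then for every $\delta>0$, $$\limsup_{n\to\infty}E\big[(\Delta_{n+ns_\delta}-\Delta_n)\mathbf 1_{Q(\delta,n)^c}\big]\le0.$$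
   Context: ARRU model. Let $0<a\le b<\infty$ ($b$ is the a.s. upper bound on the reinforcements), $u:S\to[a,b]$ measurable, $\{\xi_{1,n}\}$, $\{\xi_{2,n}\}$ independent i.i.d. sequences with laws $\mu_1,\mu_2$; $D_{j,n}=u(\xi_{j,n})$, $m_j=E[D_{j,n}]$. $\{U_n\}$ i.i.d. uniform on $(0,1)$ independent of the $\xi$'s and of auxiliary variables $\varphi_n$. Initial composition $y_{1,0},y_{2,0}>0$, $y_0=y_{1,0}+y_{2,0}$; $Y_n=Y_{1,n}+Y_{2,n}$, $Z_n=Y_{1,n}/Y_n$. $\mathcal F_n=\sigma(X_i,X_i\xi_{1,i}+(1-X_i)\xi_{2,i},\varphi_i:i\le n)$, $U_{n+1}$ independent of $\mathcal F_n$ and the $\xi$'s. Thresholds $\hat\rho_{1,n}\ge\hat\rho_{2,n}$ are $[0,1]$-valued, $\mathcal F_n$-measurable. For $n\ge0$: $X_{n+1}=\mathbf 1\{U_{n+1}\le Z_n\}$, $W_{1,n}=\mathbf 1\{Z_n\le\hat\rho_{1,n}\}$, $W_{2,n}=\mathbf 1\{Z_n\ge\hat\rho_{2,n}\}$, $Y_{1,n+1}=Y_{1,n}+X_{n+1}D_{1,n+1}W_{1,n}$, $Y_{2,n+1}=Y_{2,n}+(1-X_{n+1})D_{2,n+1}W_{2,n}$. The time index $n+ns_\delta$ is understood with $ns_\delta$ rounded to an integer. *)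

(* Defs.v *)
From HB Require Import structures.
From mathcomp Require Import all_boot all_order all_algebra.
From mathcomp Require Import finmap.
From mathcomp Require Import all_classical all_reals all_analysis.

Set Implicit Arguments.
Unset Strict Implicit.
Unset Printing Implicit Defensive.

Import Order.TTheory GRing.Theory Num.Theory.
Local Open Scope classical_set_scope.
Local Open Scope ring_scope.

Definition rv_events d d' (T : measurableType d) (V : measurableType d')
  (X : T -> V) : set (set T) :=
  fun A => exists2 B, measurable B & A = X @^-1` B.

Definition gen_sigma (T : Type) (G : set (set T)) : set (set T) :=
  smallest (sigma_algebra setT) G.

Definition mutually_independent d (T : measurableType d) (R : realType)
  (P : probability T R) (I : choiceType) (G : I -> set (set T)) : Prop :=
  forall (J : {fset I}) (A : I -> set T),
    (forall j, j \in J -> G j (A j)) ->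
    P (\bigcap_(j in [set` J]) A j) = (\prod_(j <- J) P (A j))%E.

Definition cvg_in_prob d (T : measurableType d) (R : realType)
  (P : probability T R) (X : nat -> T -> R) (l : R) : Prop :=
  forall e : R, 0 < e ->
    (fun n => P [set w | e < `|X n w - l|]) @ \oo --> 0%E.

Section ARRU.
Context d dS (T : measurableType d) (S : measurableType dS) (R : realType).
Variables (u : S -> R) (xi1 xi2 : nat -> T -> S) (U : nat -> T -> R)
  (rho1h rho2h : nat -> T -> R) (y10 y20 : R).

Fixpoint arru_Y (n : nat) (w : T) : R * R :=
  match n with
  | 0%N => (y10, y20)
  | k.+1 =>
    let: (y1, y2) := arru_Y k w in
    let z := y1 / (y1 + y2) in
    let x := (U k.+1 w <= z)%R in
    let w1 := (z <= rho1h k w)%R in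
    let w2 := (rho2h k w <= z)%R in
    (if x && w1 then y1 + u (xi1 k.+1 w) else y1,
     if (~~ x) && w2 then y2 + u (xi2 k.+1 w) else y2)
  end.

Definition arru_Y1 n w := (arru_Y n w).1.
Definition arru_Y2 n w := (arru_Y n w).2.
Definition arru_Ytot n w := arru_Y1 n w + arru_Y2 n w.
Definition arru_Z n w := arru_Y1 n w / arru_Ytot n w.

(** X_n (n >= 1) as a real 0/1 variable; X_0 is unused (set to 0). *)
Definition arru_X (n : nat) (w : T) : R :=
  match n with
  | 0%N => 0
  | k.+1 => ((U k.+1 w <= arru_Z k w)%R)%:R
  end.

Definition arru_obs (n : nat) (w : T) : S :=
  if arru_X n w == 1 then xi1 n w else xi2 n w.

Definition arru_F dP (Phi : measurableType dP) (phi : nat -> T -> Phi)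
  (n : nat) : set (set T) :=
  gen_sigma (fun A =>
    (exists i, (1 <= i <= n)%N /\
       (rv_events (arru_X i) A \/ rv_events (arru_obs i) A)) \/
    (exists i, (i <= n)%N /\ rv_events (phi i) A)).

End ARRU.

(* Main.v *)
(** The increments of [Delta] are controlled through the Huber function [h] of [Z - rho1],
which is within [eta / 2] of [Delta] and has a Lipschitz slope. By Taylor, an increment
of [h (Z - rho1)] is the slope times the drift of [Z], plus a conditionally centred
noise, plus [O(1 / Y ^ 2)]. Up to the event that the first threshold is far from
[rho1], the drift points towards [rho1], except that to its left it is only bounded
below by [Z (1 - Z) (D1 - D2) / Y]. As the thresholds may depend on future
reinforcements (the auxiliary variables are not assumed independent of the [xi]s),
[D1 - D2] cannot be conditioned on the past; but [Y] and [Z] vary slowly, so a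
summation by parts leaves only partial sums of [D2 - D1 + m1 - m2], whose L2 norm
is [O(sqrt n)], against weights [O(1 / n)]. *)

Require Import Defs.
From HB Require Import structures.
From mathcomp Require Import all_boot all_order all_algebra.
From mathcomp Require Import finmap.
From mathcomp Require Import all_classical all_reals all_analysis.
From mathcomp Require Import measurable_realfun ring lra.
Import Order.TTheory GRing.Theory Num.Theory.

Set Implicit Arguments.
Unset Strict Implicit.
Unset Printing Implicit Defensive.

Local Open Scope classical_set_scope.
Local Open Scope ring_scope.

(** * The Huber function *)

(** Orders of magnitude dictate the bookkeeping. A window starting at time [n] has [O(n)] steps, and
    when [Y_n >= c1 n] each step moves [Z] by [O(1 / n)]. A per-step error of that order is
    affordable only with a small factor in front: the slope of [huber] near [rho1], or the
    probability of a bad threshold. Errors [O(1 / n ^ 2)] add up to [O(1 / n)]. This rules out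
    [Delta] itself: its kink gives a first-order error at every step taken close to [rho1], whereas
    smoothing at scale [eta] makes that error quadratic, at the price of factors [1 / eta]. Hence
    [eta] is fixed before [n].

    All localisation uses events of time [n] ([Y_n] not too small, [Delta_n <= delta]). They are
    known before every draw of the window, so multiplying the noise by their indicator keeps it
    centred; and [Y] never decreases, so the lower bound lasts throughout the window. *)

Definition huber_slope (R : realType) (eta t : R) := Num.max (-1) (Num.min 1 (t / eta)).

(** This is [t ^ 2 / (2 eta)] for [|t| <= eta] and [|t| - eta / 2] beyond, written as the value at
    the maximiser [v = huber_slope eta t] of [v t - eta v ^ 2 / 2] over [v] in [[-1, 1]]. In this
    form convexity needs no case analysis. *)
Definition huber (R : realType) (eta t : R) :=
  huber_slope eta t * t - eta / 2 * huber_slope eta t ^+ 2.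

Lemma huber_slopeP (R : realType) (eta t : R) : 0 < eta ->
  [\/ huber_slope eta t = -1 /\ t <= - eta,
  huber_slope eta t = 1 /\ eta <= t |
  huber_slope eta t = t / eta /\ - eta <= t <= eta].
Proof.
move=> eta_gt0.
rewrite /huber_slope /Num.max /Num.min.
have e1 : (1 < t / eta) = (eta < t) by rewrite ltr_pdivlMr// mul1r.
have e2 : (-1 < t / eta) = (- eta < t) by rewrite ltr_pdivlMr// mulN1r.
rewrite e1; case: (ltrP eta t) => h1.
  by rewrite ifT; [apply: Or32; split=> //; lra|lra].
rewrite e2; case: (ltrP (- eta) t) => h2.
  by apply: Or33; split=> //; apply/andP; split; lra.
by apply: Or31.
Qed.

Lemma huber_slope_le1 (R : realType) (eta t : R) : 0 < eta ->
  -1 <= huber_slope eta t <= 1.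
Proof.
move=> eta_gt0.
case: (huber_slopeP t eta_gt0) => -[-> h]; rewrite ?lexx/= ?andbT; try lra.
by rewrite ler_pdivlMr// ler_pdivrMr// mulN1r mul1r.
Qed.

Lemma huber_slope_ge0 (R : realType) (eta t : R) : 0 < eta ->
  0 <= t -> 0 <= huber_slope eta t.
Proof.
move=> eta_gt0 t0; case: (huber_slopeP t eta_gt0) => -[-> h]; [lra|lra|].
by rewrite divr_ge0// ltW.
Qed.

Lemma huber_slope_le0 (R : realType) (eta t : R) : 0 < eta ->
  t <= 0 -> huber_slope eta t <= 0.
Proof.
move=> eta_gt0 t0; case: (huber_slopeP t eta_gt0) => -[-> h]; [lra|lra|].
by rewrite pmulr_lle0// invr_gt0.
Qed.

Lemma huber_slope_small (R : realType) (eta t e : R) : 0 < eta ->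
  `|t| <= e -> `|huber_slope eta t| <= e / eta.
Proof.
move=> eta_gt0 te; rewrite ler_pdivlMr//; move: te; rewrite ler_norml => te.
have [] := huber_slopeP t eta_gt0 => -[-> h]; rewrite ?normrN1 ?normr1; try lra.
rewrite normrM normfV (gtr0_norm eta_gt0) divfK ?gt_eqF//.
by rewrite ler_norml.
Qed.

Lemma huber_slope_lip (R : realType) (eta t t' : R) : 0 < eta ->
  `|huber_slope eta t' - huber_slope eta t| <= `|t' - t| / eta.
Proof.
move=> eta_gt0.
have D : t' - t <= `|t' - t| by exact: ler_norm.
have D' : t - t' <= `|t' - t| by rewrite distrC; exact: ler_norm.
have H (s : R) : s / eta * eta = s by rewrite divfK// gt_eqF.
rewrite ler_pdivlMr// -[X in _ * X](gtr0_norm eta_gt0) -normrM ler_norml mulrBl.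
by case: (huber_slopeP t eta_gt0) => -[-> h]; case: (huber_slopeP t' eta_gt0) => -[-> h'];
   rewrite ?H; apply/andP; split; lra.
Qed.

Lemma huber_sup (R : realType) (eta t v : R) : 0 < eta ->
  -1 <= v <= 1 -> v * t - eta / 2 * v ^+ 2 <= huber eta t.
Proof.
move=> eta_gt0 hv; rewrite /huber; case: (huber_slopeP t eta_gt0) => -[-> h].
- suff : 0 <= (v + 1) * (- t - eta) + eta / 2 * (v + 1) ^+ 2 by lra.
  apply: addr_ge0; apply: mulr_ge0; rewrite ?sqr_ge0//; lra.
- suff : 0 <= (1 - v) * (t - eta) + eta / 2 * (v - 1) ^+ 2 by lra.
  apply: addr_ge0; apply: mulr_ge0; rewrite ?sqr_ge0//; lra.
- rewrite -subr_ge0; set w := t / eta.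
  have -> : t = w * eta by rewrite /w divfK// gt_eqF.
  suff -> : w * (w * eta) - eta / 2 * w ^+ 2 - (v * (w * eta) - eta / 2 * v ^+ 2)
    = eta / 2 * (w - v) ^+ 2 by rewrite mulr_ge0 ?sqr_ge0//; lra.
  by field.
Qed.

(* [huber] is a supremum of affine functions attained at slope [huber_slope]. *)
Lemma huber_subgradient (R : realType) (eta t t' : R) : 0 < eta ->
  huber eta t' - huber eta t <= huber_slope eta t' * (t' - t).
Proof.
move=> eta_gt0.
have := huber_sup t eta_gt0 (huber_slope_le1 t' eta_gt0).
by rewrite {2}/huber; lra.
Qed.

(** The subgradient bound has the slope at the endpoint [t']; moving it to [t], where it is known
    before the draw, costs one application of the Lipschitz bound. *)
Lemma huber_taylor (R : realType) (eta t t' : R) : 0 < eta ->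
  huber eta t' - huber eta t <= huber_slope eta t * (t' - t) + (t' - t) ^+ 2 / eta.
Proof.
move=> eta_gt0.
apply: le_trans (huber_subgradient _ _ eta_gt0) _.
rewrite -lerBlDl -mulrBl; apply: le_trans (ler_norm _) _.
rewrite normrM -[leRHS]ger0_norm; last by rewrite divr_ge0 ?sqr_ge0// ltW.
rewrite expr2 mulrAC normrM; apply: ler_wpM2r => //.
rewrite normrM normfV (gtr0_norm eta_gt0).
exact: huber_slope_lip.
Qed.

Lemma huber_le_norm (R : realType) (eta t : R) : 0 < eta ->
  huber eta t <= `|t|.
Proof.
move=> eta_gt0.
rewrite /huber.
have h1 : huber_slope eta t * t <= `|t|.
  apply: le_trans (ler_norm _) _; rewrite normrM ler_piMl//.
  by rewrite ler_norml huber_slope_le1.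
have h2 : 0 <= eta / 2 * huber_slope eta t ^+ 2 by rewrite mulr_ge0 ?sqr_ge0//; lra.
lra.
Qed.

Lemma norm_le_huber (R : realType) (eta t : R) : 0 < eta -> `|t| <= huber eta t + eta / 2.
Proof.
move=> eta_gt0.
have h1 : -1 <= (1 : R) <= 1 by lra.
have h2 : -1 <= (-1 : R) <= 1 by lra.
have := huber_sup t eta_gt0 h1; have := huber_sup t eta_gt0 h2.
rewrite ler_norml; rewrite sqrrN expr1n; lra.
Qed.

(** * Drift of the urn along a trajectory *)

(** With [V = v1 + v2] and [N] the numerator of [m], the increment is exactly [N / (Y + V)]. Putting
    the old total in the denominator, which is known before the draw, leaves the error
    [N V / (Y (Y + V))]. A draw adds one colour only, hence [v1 * v2 = 0] and [V <= b]. *)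
Lemma urn_proportion_step (R : realType) (b y1 y2 v1 v2 : R) :
  0 < y1 -> 0 < y2 -> 0 <= v1 <= b -> 0 <= v2 <= b -> v1 * v2 = 0 ->
  let z := y1 / (y1 + y2) in
  let z' := (y1 + v1) / ((y1 + v1) + (y2 + v2)) in
  let m := ((1 - z) * v1 - z * v2) / (y1 + y2) in
  [/\ `|z' - z| <= b / (y1 + y2) & `|z' - z - m| <= (b / (y1 + y2)) ^+ 2].
Proof.
move=> y1p y2p v1b v2b v12 z z' m.
set Y := y1 + y2; have Yp : 0 < Y by rewrite /Y; lra.
set N := (1 - z) * v1 - z * v2.
have z01 : 0 <= z <= 1.
  by rewrite /z divr_ge0 ?ler_pdivrMr//=; lra.
set V := v1 + v2.
have bV : 0 <= V <= b.
  by move/eqP: v12; rewrite mulf_eq0 /V => /orP[] /eqP ->; lra.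
have YVp : 0 < Y + V by lra.
have zN : z' - z = N / (Y + V).
  rewrite /z' /N /z /V -/Y -/V; have -> : y1 + v1 + (y2 + v2) = Y + V.
    by rewrite /Y /V; ring.
  by rewrite /V /Y; field; rewrite /Y /V in Yp YVp; rewrite !gt_eqF.
have Nb : `|N| <= b.
  rewrite /N ler_norml; apply/andP; split.
    have : 0 <= (1 - z) * v1 by rewrite mulr_ge0//; lra.
    have : 0 <= (1 - z) * v2 by rewrite mulr_ge0//; lra.
    lra.
  have : 0 <= z * v1 by rewrite mulr_ge0//; lra.
  have : 0 <= z * v2 by rewrite mulr_ge0//; lra.
  lra.
have b0 : 0 <= b by lra.
split.
  rewrite zN normrM normfV (gtr0_norm YVp); apply: ler_pM => //.
    by rewrite invr_ge0 ltW.
  by rewrite lef_pV2 ?posrE//; lra.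
have -> : z' - z - m = - (N / Y * (V / (Y + V))).
  by rewrite zN /m -/N -/Y; field; rewrite !gt_eqF.
rewrite normrN normrM expr2; apply: ler_pM => //; rewrite normrM normfV.
  by rewrite (gtr0_norm Yp) ler_wpM2r// invr_ge0 ltW.
rewrite (gtr0_norm YVp) (ger0_norm (_ : 0 <= V)); last by lra.
apply: ler_pM; rewrite ?invr_ge0; try lra.
by rewrite lef_pV2 ?posrE//; lra.
Qed.

(* The weight of [D1 - D2] in the drift left of [rho]; to the right of [rho] it is
   zero, since there the first colour is not reinforced. *)
Definition pull (R : realType) (eta t z : R) :=
  Num.max 0 (- huber_slope eta t) * (z * (1 - z)).

Lemma pull_ge0 (R : realType) (eta t z : R) : 0 <= z <= 1 -> 0 <= pull eta t z.
Proof.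
by move=> z01; rewrite /pull mulr_ge0 ?le_max ?lexx// mulr_ge0//; lra.
Qed.

Lemma pull_le1 (R : realType) (eta t z : R) : 0 < eta -> 0 <= z <= 1 ->
  pull eta t z <= 1.
Proof.
move=> eta_gt0 z01; rewrite /pull -[leRHS]mulr1.
have h := huber_slope_le1 t eta_gt0.
have zz : 0 <= z * (1 - z) by rewrite mulr_ge0//; lra.
rewrite ler_pM ?le_max ?lexx ?ge_max//; first by apply/andP; split; lra.
have : 0 <= z * z by rewrite mulr_ge0//; lra.
lra.
Qed.

(** Product rule for two factors with values in [[0, 1]] and Lipschitz constants [1 / eta] and
    [1]. *)
Lemma pull_lip (R : realType) (eta t z t' z' : R) : 0 < eta ->
  0 <= z <= 1 -> 0 <= z' <= 1 -> z' - z = t' - t ->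
  `|pull eta t' z' - pull eta t z| <= (eta^-1 + 1) * `|z' - z|.
Proof.
move=> eta_gt0 hz hz' zt; rewrite /pull.
set s := huber_slope eta t; set s' := huber_slope eta t'.
set q := z * (1 - z); set q' := z' * (1 - z').
have ss : `|Num.max 0 (- s') - Num.max 0 (- s)| <= `|z' - z| / eta.
  rewrite zt; apply: le_trans (huber_slope_lip t t' eta_gt0).
  rewrite -/s -/s' /Num.max !oppr_gt0.
  have H := ler_norm (s' - s); have H' := ler_normr (s' - s) (s - s').
  have H2 : s - s' <= `|s' - s| by rewrite distrC ler_norm.
  by case: ifP => h1; case: ifP => h2; rewrite ler_norml; lra.
have s1 : -1 <= s <= 1 by exact: huber_slope_le1.
have s01 : 0 <= Num.max 0 (- s) <= 1 by rewrite le_max lexx ge_max ler01 /=; lra.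
have q01 : 0 <= q' <= 1.
  rewrite /q'; apply/andP; split; first by rewrite mulr_ge0//; lra.
  have : 0 <= z' * z' by rewrite mulr_ge0//; lra.
  lra.
have qq : `|q' - q| <= `|z' - z|.
  have -> : q' - q = (1 - z - z') * (z' - z) by rewrite /q /q'; ring.
  by rewrite normrM ler_piMl// ler_norml; lra.
have -> : Num.max 0 (- s') * q' - Num.max 0 (- s) * q =
  (Num.max 0 (- s') - Num.max 0 (- s)) * q' + Num.max 0 (- s) * (q' - q) by ring.
apply: le_trans (ler_normD _ _) _; rewrite [leRHS]mulrDl mul1r.
apply: lerD; rewrite normrM.
  rewrite (ger0_norm (_ : 0 <= q')); last lra.
  by rewrite [leRHS]mulrC; apply: le_trans ss; rewrite ler_piMr//; lra.
rewrite (ger0_norm (_ : 0 <= Num.max 0 (- s))); last lra.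
by apply: le_trans qq; rewrite ler_piMl//; lra.
Qed.

(* Left of [rho - e] only the threshold for the first colour matters and the drift is
   at least that of the unthresholded urn; right of [rho + e] it is nonpositive; in
   between the slope of [huber] is at most [e / eta]. *)
Lemma drift_le (R : realType) (eta e rho b z r D1 D2 : R) (w2 : bool) :
  0 < eta -> 0 < e -> 0 <= z <= 1 -> 0 <= D1 <= b -> 0 <= D2 <= b ->
  huber_slope eta (z - rho) * (z * (1 - z) * (D1 * (z <= r)%R%:R - D2 * w2%:R))
  <= pull eta (z - rho) z * (D2 - D1) + b * (e / eta + (e < `|r - rho|)%R%:R).
Proof.
move=> eta_gt0 e_gt0 hz hD1 hD2; rewrite /pull.
have ee : 0 <= e / eta by rewrite divr_ge0// ltW.
set s := huber_slope eta (z - rho); set q := z * (1 - z).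
have [q0 q1] : 0 <= q /\ q + q <= 1.
  rewrite /q; split; first by rewrite mulr_ge0//; lra.
  have -> : z * (1 - z) + z * (1 - z) = 1 - (z * z + (1 - z) * (1 - z)) by ring.
  by rewrite gerBl addr_ge0// mulr_ge0//; lra.
have s1 : -1 <= s <= 1 by exact: huber_slope_le1.
set p1 := D1 * _; set p2 := D2 * _.
have hp1 : 0 <= p1 <= b by rewrite /p1; case: (z <= r); rewrite ?mulr1 ?mulr0; lra.
have hp2 : 0 <= p2 <= D2 by rewrite /p2; case: (w2); rewrite ?mulr1 ?mulr0; lra.
have b0 : 0 <= b by lra.
set m := Num.max 0 (- s).
have m0 : 0 <= m by rewrite /m le_max lexx.
(* Serves both exceptional cases, a bad threshold with [c = 1] and [z] close to [rho] with
   [c = e / eta]. The left side and the negative of the pull term are each at most [c * (q * b)],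
   and [q + q <= 1]. *)
have crude c : `|s| <= c -> s * (q * (p1 - p2)) <= m * q * (D2 - D1) + b * c.
  move=> sc; have c0 : 0 <= c by apply: le_trans sc.
  have h1 : s * (q * (p1 - p2)) <= c * (q * b).
    apply: le_trans (ler_norm _) _; rewrite normrM; apply: ler_pM => //.
    by rewrite normrM (ger0_norm q0) ler_wpM2l// ler_norml; lra.
  have mc : m <= c.
    by rewrite /m ge_max c0/= (le_trans _ sc)// -normrN ler_norm.
  have h2 : m * q * (D1 - D2) <= c * (q * b).
    rewrite -mulrA; apply: (@le_trans _ _ (m * (q * b))).
      by apply: ler_wpM2l => //; apply: ler_wpM2l => //; lra.
    by apply: ler_wpM2r => //; apply: mulr_ge0.
  have : c * (q + q) * b <= c * 1 * b by apply: ler_wpM2r => //; apply: ler_wpM2l.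
  lra.
have [hr|hr] /= := ltrP e `|r - rho|.
  have /crude/le_trans : `|s| <= 1 by rewrite ler_norml.
  by apply; rewrite lerD2l; apply: ler_wpM2l => //; lra.
rewrite addr0; have [/huber_slope_small/crude//|] := lerP `|z - rho| e; first exact.
have bee : 0 <= b * (e / eta) by exact: mulr_ge0.
move: hr; rewrite ler_norml => hr; rewrite ltr_normr => /orP[ze|ze].
  have s0 : 0 <= s by apply: huber_slope_ge0 => //; lra.
  have -> : p1 = 0 by rewrite /p1 (_ : z <= r = false) ?mulr0//; apply/negbTE; rewrite -ltNge; lra.
  have -> : m = 0 by rewrite /m; apply/max_idPl; lra.
  have : 0 <= s * (q * p2) by rewrite mulr_ge0// mulr_ge0//; lra.
  lra.
have s0 : s <= 0 by apply: huber_slope_le0 => //; lra.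
have -> : p1 = D1 by rewrite /p1 (_ : z <= r) ?mulr1//; lra.
have -> : m = - s by rewrite /m; apply/max_idPr; lra.
have : 0 <= - s * (q * (D2 - p2)) by rewrite mulr_ge0// ?mulr_ge0//; lra.
lra.
Qed.

(** Here [p] and [q] are the reinforcements after thresholding and [x] is the colour indicator. The
    first-order increment is [((1 - z) x p - z (1 - x) q) / Y]; subtracting its value at [x = z],
    the drift [z (1 - z) (p - q) / Y], leaves exactly a multiple of [x - z]. *)
Definition noise (R : realType) (eta rho y1 y2 p q x : R) :=
  let z := y1 / (y1 + y2) in
  huber_slope eta (z - rho) * (((1 - z) * p + z * q) / (y1 + y2)) * (x - z).

(** One step of the summation by parts: the increment, the variation and the size of the weight
    [pull / Y], and the invariants handed to the next step. The bound [L] survives because the total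
    never decreases. *)
Lemma huber_step (R : realType) (eta e rho b L y1 y2 y1' y2' r D1 D2 : R)
    (x w2 : bool) :
  0 < eta -> 0 < e -> 0 < L -> 0 <= D1 <= b -> 0 <= D2 <= b ->
  0 < y1 -> 0 < y2 -> L <= y1 + y2 ->
  let z := y1 / (y1 + y2) in
  let z' := y1' / (y1' + y2') in
  y1' = y1 + x%:R * (D1 * (z <= r)%R%:R) ->
  y2' = y2 + (~~ x)%:R * (D2 * w2%:R) ->
  [/\ huber eta (z' - rho) - huber eta (z - rho) <=
      noise eta rho y1 y2 (D1 * (z <= r)%R%:R) (D2 * w2%:R) x%:R
      + pull eta (z - rho) z / (y1 + y2) * (D2 - D1)
      + (b / L * (e < `|r - rho|)%R%:R
         + (b / L * (e / eta) + (b / L) ^+ 2 * (1 + eta^-1))),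
    `|pull eta (z' - rho) z' / (y1' + y2') - pull eta (z - rho) z / (y1 + y2)|
      <= b / L ^+ 2 * (eta^-1 + 2),
    0 <= pull eta (z - rho) z / (y1 + y2) <= L^-1 &
    [/\ 0 < y1', 0 < y2' & L <= y1' + y2']].
Proof.
move=> eta0 e0 L0 hD1 hD2 y1p y2p LY z z' y1E y2E.
set p := D1 * _ in y1E *; set q := D2 * _ in y2E *.
have hp : 0 <= p <= b by rewrite /p; case: (z <= r); rewrite ?mulr1 ?mulr0; lra.
have hq : 0 <= q <= b by rewrite /q; case: (w2); rewrite ?mulr1 ?mulr0; lra.
set v1 := x%:R * p in y1E; set v2 := (~~ x)%:R * q in y2E.
have hv1 : 0 <= v1 <= b by rewrite /v1; case: (x); rewrite ?mul1r ?mul0r; lra.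
have hv2 : 0 <= v2 <= b by rewrite /v2; case: (x); rewrite ?mul1r ?mul0r; lra.
have v12 : v1 * v2 = 0 by rewrite /v1 /v2; case: (x); rewrite ?mul0r ?mulr0.
have := urn_proportion_step y1p y2p hv1 hv2 v12; rewrite /= -y1E -y2E -/z -/z'.
set m := (_ - _) / _ => -[dz dzm].
have z01 : 0 <= z <= 1.
  by rewrite /z divr_ge0 ?ler_pdivrMr//=; lra.
have z01' : 0 <= z' <= 1.
  by rewrite /z' divr_ge0 ?ler_pdivrMr//=; lra.
have b0 : 0 <= b by lra.
set Y := y1 + y2 in LY *; have Y0 : 0 < Y by rewrite /Y; lra.
set Y' := y1' + y2'; have Y0' : 0 < Y' by rewrite /Y'; lra.
have YY : Y <= Y' <= Y + b.
  rewrite /Y' /Y y1E y2E; move/eqP: v12; rewrite mulf_eq0 => /orP[] /eqP ->; lra.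
have iY : Y^-1 <= L^-1 by rewrite lef_pV2 ?posrE.
have iY' : Y'^-1 <= L^-1 by rewrite lef_pV2 ?posrE//; lra.
have iY0 : 0 <= Y^-1 by rewrite invr_ge0 ltW.
have iY0' : 0 <= Y'^-1 by rewrite invr_ge0 ltW.
have iL0 : 0 <= L^-1 by rewrite invr_ge0 ltW.
have bY : b / Y <= b / L by rewrite ler_wpM2l.
have bY0 : 0 <= b / Y by rewrite mulr_ge0.
have bYL2 : (b / Y) ^+ 2 <= (b / L) ^+ 2 by rewrite !expr2 ler_pM.
have ie0 : 0 <= eta^-1 by rewrite invr_ge0 ltW.
have g0 := @pull_ge0 _ eta (z - rho) z z01.
have g1 := pull_le1 (z - rho) eta0 z01.
have g0' := @pull_ge0 _ eta (z' - rho) z' z01'.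
have g1' := pull_le1 (z' - rho) eta0 z01'.
split.
- set s := huber_slope eta (z - rho).
  have hs : -1 <= s <= 1 by exact: huber_slope_le1.
  apply: le_trans (huber_taylor (z - rho) (z' - rho) eta0) _.
  have -> : z' - rho - (z - rho) = z' - z by ring.
  rewrite -/s.
  have h1 : (z' - z) ^+ 2 / eta <= (b / L) ^+ 2 * eta^-1.
    rewrite ler_wpM2r// -real_normK ?num_real//; apply: le_trans bYL2.
    by rewrite !expr2 ler_pM.
  have h2 : s * (z' - z) <= s * m + (b / L) ^+ 2.
    rewrite -lerBlDl -mulrBr; apply: le_trans (ler_norm _) _.
    rewrite normrM -[leRHS]mul1r; apply: ler_pM => //; first by rewrite ler_norml.
    exact: le_trans bYL2.
  have h3 : s * m = noise eta rho y1 y2 p q x%:R + s * (z * (1 - z) * (p - q)) / Y.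
    rewrite /m /noise -/z -/s -/Y /v1 /v2.
    by case: (x); rewrite /= ?mul0r ?mul1r ?mulr0 ?subr0 ?sub0r; field; exact: lt0r_neq0.
  have := @drift_le _ eta e rho b z r D1 D2 w2 eta0 e0 z01 hD1 hD2.
  rewrite -/p -/q -/s; set g := pull _ _ _; set B := (e < _)%R%:R.
  have B0 : 0 <= B :> R by rewrite /B ler0n.
  move/(ler_wpM2r iY0); rewrite [leRHS]mulrDl => h4.
  have h5 : b * (e / eta + B) / Y <= b / L * (e / eta + B).
    rewrite mulrAC ler_wpM2r// addr_ge0// divr_ge0// ltW//.
  have -> : g / Y * (D2 - D1) = g * (D2 - D1) / Y by ring.
  lra.
- set g := pull _ _ _; set g' := pull _ _ _.
  (* Of the constant [eta^-1 + 2], the change of [pull] takes [eta^-1 + 1] and the change of the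
     reciprocal total takes [1]. *)
  have -> : g / Y' - g' / Y = (g - g') / Y + g * (Y'^-1 - Y^-1) by ring.
  apply: le_trans (ler_normD _ _) _; rewrite [eta^-1 + 2](_ : _ = eta^-1 + 1 + 1); last by ring.
  rewrite [leRHS]mulrDr mulr1; apply: lerD; rewrite normrM.
    have : `|g - g'| <= (eta^-1 + 1) * `|z' - z|.
      by apply: pull_lip => //; ring.
    move=> h; rewrite (ger0_norm iY0).
    rewrite (_ : b / L ^+ 2 * _ = (eta^-1 + 1) * (b / L) / L); last first.
      by rewrite expr2 invfM; ring.
    apply: ler_pM => //; apply: le_trans h _; rewrite ler_wpM2l//; first lra.
    exact: le_trans bY.
  rewrite -[leRHS]mul1r; apply: ler_pM => //; first by rewrite ger0_norm.
  have -> : Y'^-1 - Y^-1 = - ((Y' - Y) * Y^-1 * Y'^-1).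
    by field; rewrite !gt_eqF.
  rewrite normrN ger0_norm; last by rewrite !mulr_ge0//; lra.
  rewrite expr2 invfM mulrA.
  have YYb : 0 <= Y' - Y <= b by lra.
  by rewrite !ler_pM ?mulr_ge0//; lra.
- rewrite mulr_ge0//= -[leRHS]mul1r; exact: ler_pM.
- by split; [lra|lra|rewrite -/Y'; lra].
Qed.

(* Summation by parts: [pull] varies slowly, so only the partial sums of the centred
   [D2 - D1 + m] enter, whatever the dependence between the urn and the [D]s. *)
Lemma huber_path (R : realType) (eta e rho b L m : R) (y1 y2 D1 D2 r : nat -> R)
    (x w2 : nat -> bool) :
  0 < eta -> 0 < e -> 0 < L -> 0 <= m ->
  (forall i, 0 <= D1 i <= b) -> (forall i, 0 <= D2 i <= b) ->
  0 < y1 0%N -> 0 < y2 0%N -> L <= y1 0%N + y2 0%N ->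
  let z i := y1 i / (y1 i + y2 i) in
  let S k := \sum_(i < k) (D2 i - D1 i + m) in
  (forall i, y1 i.+1 = y1 i + (x i)%:R * (D1 i * (z i <= r i)%R%:R)) ->
  (forall i, y2 i.+1 = y2 i + (~~ x i)%:R * (D2 i * (w2 i)%:R)) ->
  forall k, huber eta (z k - rho) - huber eta (z 0%N - rho) <=
    \sum_(i < k) noise eta rho (y1 i) (y2 i) (D1 i * (z i <= r i)%R%:R)
                   (D2 i * (w2 i)%:R) (x i)%:R
    + \sum_(i < k) b / L * (e < `|r i - rho|)%R%:R
    + k%:R * (b / L * (e / eta) + (b / L) ^+ 2 * (1 + eta^-1))
    + \sum_(i < k) b / L ^+ 2 * (eta^-1 + 2) * `|S i.+1|
    + L^-1 * `|S k|.
Proof.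
move=> eta0 e0 L0 m0 hD1 hD2 y1p y2p LY z S y1E y2E k.
pose G i := pull eta (z i - rho) (z i) / (y1 i + y2 i).
have pos i : [/\ 0 < y1 i, 0 < y2 i & L <= y1 i + y2 i].
  elim: i => [|i [h1 h2 h3]]; first by [].
  by have [] := huber_step rho eta0 e0 L0 (hD1 i) (hD2 i) h1 h2 h3 (y1E i) (y2E i).
suff H : huber eta (z k - rho) - huber eta (z 0%N - rho) <=
    \sum_(i < k) noise eta rho (y1 i) (y2 i) (D1 i * (z i <= r i)%R%:R)
                   (D2 i * (w2 i)%:R) (x i)%:R
    + \sum_(i < k) b / L * (e < `|r i - rho|)%R%:R
    + k%:R * (b / L * (e / eta) + (b / L) ^+ 2 * (1 + eta^-1))
    + \sum_(i < k) b / L ^+ 2 * (eta^-1 + 2) * `|S i.+1|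
    + G k * S k.
  apply: le_trans H _; rewrite lerD2l; apply: le_trans (ler_norm _) _.
  have [h1 h2 h3] := pos k.
  have [_ _ /andP[G0 G1] _] :=
    huber_step rho eta0 e0 L0 (hD1 k) (hD2 k) h1 h2 h3 (y1E k) (y2E k).
  by rewrite normrM ler_wpM2r// ger0_norm.
elim: k => [|k IH].
  by rewrite /S !big_ord0 subrr mul0r mulr0 !addr0.
rewrite !big_ord_recr/=.
have [h1 h2 h3] := pos k.
have [H1 H2 /andP[G0 _] _] :=
    huber_step rho eta0 e0 L0 (hD1 k) (hD2 k) h1 h2 h3 (y1E k) (y2E k).
rewrite -/(z k) -/(z k.+1) -/(G k) -/(G k.+1) in H1 H2 G0.
have SE : S k.+1 = S k + (D2 k - D1 k + m) by rewrite /S big_ord_recr.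
(* Abel summation for the centred increments. Passing from [D2 - D1] to [D2 - D1 + m] adds
   [G k * m], which is nonnegative: this is the mean drift being discarded. *)
have E1 : G k * (D2 k - D1 k) <= G k.+1 * S k.+1 - G k * S k - (G k.+1 - G k) * S k.+1.
  have -> : G k.+1 * S k.+1 - G k * S k - (G k.+1 - G k) * S k.+1
    = G k * (D2 k - D1 k) + G k * m by rewrite SE; ring.
  by rewrite lerDl mulr_ge0.
have E2 : - ((G k.+1 - G k) * S k.+1) <= b / L ^+ 2 * (eta^-1 + 2) * `|S k.+1|.
  by apply: le_trans (ler_norm _) _; rewrite normrN normrM ler_wpM2r.
rewrite -/(S k.+1) -[in (k.+1)%:R]addn1 natrD mulrDl mul1r.
lra.
Qed.

(** * Bounded random variables *)

Lemma measurable_fun_invr d (T : measurableType d) (R : realType) (f : T -> R) :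
  (forall w, f w != 0) -> measurable_fun setT f ->
  measurable_fun setT (fun w => (f w)^-1).
Proof.
move=> f0 mf.
apply: (@measurable_comp _ _ _ _ _ _ [set r : R | r != 0] (fun r => r^-1)) => //.
- by apply: open_measurable; exact: open_neq.
- by move=> _ [w _ <-]; exact: f0.
- apply: open_continuous_measurable_fun; first exact: open_neq.
  by move=> r; rewrite inE/= => r0; exact: inv_continuous.
Qed.

(** The bound holds everywhere and no measure is mentioned, so the notion also makes sense over a
    sub-sigma-algebra, is stable under the operations used below, and settles all integrability
    questions. *)
Definition bounded_rv d (T : measurableType d) (R : realType) (f : T -> R) :=
  measurable_fun setT f /\ exists M : R, forall w, `|f w| <= M.

Section BoundedRV.
Context d (T : measurableType d) (R : realType).
Implicit Types f g : T -> R.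

Lemma bounded_rv_cst (c : R) : bounded_rv (cst c : T -> R).
Proof. by split; [exact: measurable_cst|exists `|c|]. Qed.

Lemma bounded_rvD f g : bounded_rv f -> bounded_rv g -> bounded_rv (fun w => f w + g w).
Proof.
move=> [mf [M hM]] [mg [N hN]]; split; first exact: measurable_funD.
by exists (M + N) => w; apply: le_trans (ler_normD _ _) _; exact: lerD.
Qed.

Lemma bounded_rvM f g : bounded_rv f -> bounded_rv g -> bounded_rv (fun w => f w * g w).
Proof.
move=> [mf [M hM]] [mg [N hN]]; split; first exact: measurable_funM.
by exists (M * N) => w; rewrite normrM; exact: ler_pM.
Qed.

Lemma bounded_rvZ (c : R) f : bounded_rv f -> bounded_rv (fun w => c * f w).
Proof. by move=> ?; apply: bounded_rvM => //; exact: bounded_rv_cst. Qed.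

Lemma bounded_rvB f g : bounded_rv f -> bounded_rv g -> bounded_rv (fun w => f w - g w).
Proof.
move=> [mf [M hM]] [mg [N hN]]; split; first exact: measurable_funB.
by exists (M + N) => w; apply: le_trans (ler_normB _ _) _; exact: lerD.
Qed.

Lemma bounded_rv_sum n (f : nat -> T -> R) : (forall i, (i < n)%N -> bounded_rv (f i)) ->
  bounded_rv (fun w => \sum_(i < n) f i w).
Proof.
elim: n => [|n IH] bf; under eq_fun do rewrite ?big_ord0 ?big_ord_recr/=.
  exact: bounded_rv_cst.
apply: bounded_rvD; last exact: bf.
by apply: IH => i /ltnW; exact: bf.
Qed.

Lemma bounded_rv_normr f : bounded_rv f -> bounded_rv (fun w => `|f w|).
Proof.
move=> [mf [M hM]]; split; first exact: measurableT_comp.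
by exists M => w; rewrite normr_id.
Qed.

Lemma bounded_rv_indic (A : set T) : measurable A -> bounded_rv (\1_A : T -> R).
Proof.
move=> mA; split; first exact: measurable_indic.
by exists 1 => w; rewrite indicE; case: (_ \in _); rewrite ?normr1 ?normr0.
Qed.

Lemma bounded_rv_bool (h : T -> bool) : measurable_fun setT h ->
  bounded_rv (fun w => (h w)%:R : R).
Proof.
move=> mh; split; last by exists 1 => w; case: (h w); rewrite ?normr1 ?normr0.
by rewrite (_ : (fun w => _) = (fun b : bool => b%:R) \o h)//; exact: measurableT_comp.
Qed.

Variable P : probability T R.

Lemma bounded_rv_integrable f : bounded_rv f -> P.-integrable setT (EFin \o f).
Proof.
move=> [mf [M hM]]; apply: measurable_bounded_integrable => //.
  by rewrite [X in (X < _)%E]probability_setT ltry.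
by exists M; split; [exact: num_real|move=> x Mx w _ /=; apply: le_trans (hM w) (ltW Mx)].
Qed.

Lemma EFin_Rintegral_bounded_rv f : bounded_rv f ->
  (\int[P]_w f w)%:E = (\int[P]_w (f w)%:E)%E.
Proof.
by move=> bf; rewrite /Rintegral fineK//; apply: integrable_fin_num => //; exact: bounded_rv_integrable.
Qed.

Lemma Rintegral_bounded_rvD f g : bounded_rv f -> bounded_rv g ->
  \int[P]_w (f w + g w) = \int[P]_w f w + \int[P]_w g w.
Proof. by move=> bf bg; apply: RintegralD => //; exact: bounded_rv_integrable. Qed.

Lemma Rintegral_bounded_rvB f g : bounded_rv f -> bounded_rv g ->
  \int[P]_w (f w - g w) = \int[P]_w f w - \int[P]_w g w.
Proof. by move=> bf bg; apply: RintegralB => //; exact: bounded_rv_integrable. Qed.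

Lemma Rintegral_bounded_rvZ (c : R) f : bounded_rv f ->
  \int[P]_w (c * f w) = c * \int[P]_w f w.
Proof. by move=> bf; apply: RintegralZl => //; exact: bounded_rv_integrable. Qed.

Lemma Rintegral_prob_cst (c : R) : \int[P]_w c = c.
Proof. by rewrite Rintegral_cst// [X in fine X]probability_setT mulr1. Qed.

Lemma Rintegral_bounded_rv_le f g : bounded_rv f -> bounded_rv g ->
  (forall w, f w <= g w) ->
  \int[P]_w f w <= \int[P]_w g w.
Proof. by move=> bf bg fg; apply: le_Rintegral => //; exact: bounded_rv_integrable. Qed.

Lemma Rintegral_bounded_rv_sum n (f : nat -> T -> R) :
  (forall i, (i < n)%N -> bounded_rv (f i)) ->
  \int[P]_w (\sum_(i < n) f i w) = \sum_(i < n) \int[P]_w f i w.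
Proof.
elim: n => [|n IH] bf.
  rewrite big_ord0; under eq_Rintegral do rewrite big_ord0.
  exact: Rintegral_prob_cst.
rewrite big_ord_recr/= -IH; last by move=> i /ltnW; exact: bf.
rewrite -Rintegral_bounded_rvD; last 2 first.
- by apply: bounded_rv_sum => i /ltnW; exact: bf.
- exact: bf.
by under eq_Rintegral do rewrite big_ord_recr.
Qed.

Lemma Rintegral_indic (A : set T) : measurable A ->
  \int[P]_w (\1_A w : R) = fine (P A).
Proof. by move=> mA; rewrite /Rintegral integral_indic// setIT. Qed.

End BoundedRV.

(** Independence on rectangles identifies the law of the pair with the product law; Fubini then
    integrates [X] first, with [Y] frozen. It is applied to the noise, with [Y] the identity into a
    smaller sigma-algebra, and to products of centred reinforcements. *)
Lemma indep_Rintegral_eq0 d d1 d2 (T : measurableType d) (T1 : measurableType d1)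
    (T2 : measurableType d2) (R : realType) (P : probability T R)
    (X : T -> T1) (Y : T -> T2) (f : T1 * T2 -> R) :
  measurable_fun setT X -> measurable_fun setT Y ->
  (forall A B, measurable A -> measurable B ->
     P (X @^-1` A `&` Y @^-1` B) = (P (X @^-1` A) * P (Y @^-1` B))%E) ->
  bounded_rv f -> (forall y, \int[P]_w f (X w, y) = 0) ->
  \int[P]_w f (X w, Y w) = 0.
Proof.
move=> mX mY XY bf f0; have [mf [M hM]] := bf.
pose X' : {mfun T >-> T1} := HB.pack X (isMeasurableFun.Build _ _ _ _ _ mX).
pose Y' : {mfun T >-> T2} := HB.pack Y (isMeasurableFun.Build _ _ _ _ _ mY).
have mXY : measurable_fun setT (fun w => (X w, Y w)) by exact: measurable_fun_pair.
pose XY' : {mfun T >-> (T1 * T2)%type} := HB.pack (fun w => (X w, Y w)) (isMeasurableFun.Build _ _ _ _ _ mXY).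
have prodE A : measurable A ->
    (distribution P X' \x distribution P Y')%E A = distribution P XY' A.
  by apply: product_measure_unique => B C mB mC; rewrite -XY.
have mfE : measurable_fun setT (EFin \o f) by exact/measurable_EFinP.
have bfXY : bounded_rv (f \o XY') by split; [exact: measurableT_comp|exists M => w; exact: hM].
rewrite /Rintegral.
transitivity (fine (\int[distribution P XY']_z (f z)%:E)).
  by rewrite integral_distribution//; exact: bounded_rv_integrable.
rewrite (eq_measure_integral (distribution P X' \x distribution P Y')%E); last first.
  by move=> A mA _; exact/esym/prodE.
rewrite -integral21_prod_meas1.
  rewrite integral0_eq// => y _; rewrite /fubini_G.
  have mfy : measurable_fun setT (fun x => f (x, y)) by exact: measurable_fun_pair1.
  have bfX : bounded_rv (fun w => f (X w, y)).
    by split; [exact: (measurableT_comp mfy mX)|exists M].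
  rewrite (@integral_distribution _ _ _ _ _ P X' (fun x => (f (x, y))%:E)).
  - by have /= <- := EFin_Rintegral_bounded_rv P bfX; rewrite f0.
  - exact/measurable_EFinP.
  - exact: (bounded_rv_integrable P bfX).
apply/integrableP; split=> //.
apply: (@le_lt_trans _ _ (\int[distribution P X' \x distribution P Y']_x `|M|%:E)%E).
  apply: ge0_le_integral => //; first exact: measurableT_comp.
  by move=> x _; rewrite lee_fin (le_trans (hM x))// ler_norm.
rewrite integral_cst//= lte_mul_pinfty ?lee_fin// prodE//.
by rewrite probability_setT ltry.
Qed.

(** * Independence *)

Section Independence.
Context d (T : measurableType d) (R : realType) (P : probability T R).
Context (I : choiceType) (G : I -> set (set T)).
Hypothesis indepG : mutually_independent P G.
Hypothesis GT : forall j, G j setT.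
Hypothesis GI : forall j, setI_closed (G j).
Hypothesis mG : forall j A, G j A -> measurable A.

Lemma independent_pair i j A B : i != j -> G i A -> G j B ->
  P (A `&` B) = (P A * P B)%E.
Proof.
move=> ij GA GB; pose F k := if k == i then A else B.
have := indepG (J := [fset i; j]%fset) (A := F).
rewrite bigcap_fsetU1 bigcap_fset big_fsetU1 ?inE// big_seq_fset1 big_seq_fset1.
rewrite /F eqxx eq_sym (negbTE ij); apply=> k; rewrite !inE => /orP[] /eqP ->.
  by rewrite eqxx.
by rewrite eq_sym (negbTE ij).
Qed.

(** Finite intersections of events from the other families form a pi-system [H], on which the finite
    measures [P (_]&[B)] and [P B * P _] agree; uniqueness of measures extends this to the generated
    sigma-algebra. *)
Lemma independent_others i A B : G i B ->
  <<s [set A | exists2 j, j != i & G j A] >> A ->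
  P (A `&` B) = (P A * P B)%E.
Proof.
move=> GB.
pose H := [set A | exists J : {fset I}, exists F : I -> set T,
  [/\ i \notin J, forall j, G j (F j) & A = \bigcap_(j in [set` J]) F j]].
have Hm : H `<=` measurable.
  move=> _ [J [F [_ GF ->]]]; rewrite bigcap_fset.
  by apply: big_ind => // [|j _]; [exact: measurableI|exact: mG (GF j)].
have HI : setI_closed H.
  move=> _ _ [J [F [iJ GF ->]]] [J' [F' [iJ' GF' ->]]].
  exists (J `|` J')%fset, (fun j => (if j \in J then F j else setT) `&`
                                    (if j \in J' then F' j else setT)).
  split; first by rewrite inE negb_or iJ.
    by move=> j; apply: GI; case: ifP.
  apply/seteqP; split => [w [h h'] j /= _|w h].
    by split; case: ifPn => // jJ; [exact: h|exact: h'].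
  split => j /= jJ; have /(_ _)/= := h j; rewrite inE jJ ?orbT => /(_ isT)[].
    by [].
  by [].
have HT : H setT.
  exists fset0, (fun=> setT); split => //.
  by rewrite set_fset0 bigcap_set0.
have mB : measurable B := mG GB.
have PBfin : P B \is a fin_num by exact: fin_num_measure.
have PB0 : 0 <= fine (P B) by rewrite fine_ge0.
have HP C : H C -> P (C `&` B) = (P C * P B)%E.
  move=> [J [F [iJ GF ->]]].
  pose F' j := if j == i then B else F j.
  have GF' j : G j (F' j) by rewrite /F'; case: eqP => [->|].
  have E1 : \bigcap_(j in [set` J]) F j = \bigcap_(j in [set` J]) F' j.
    apply: eq_bigcapr => j /= jJ; rewrite /F' ifN//.
    by apply: contraNneq iJ => <-.
  have := indepG (J := (i |` J)%fset) (A := F') (fun j _ => GF' j).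
  rewrite bigcap_fsetU1 big_fsetU1//= -indepG; last by move=> j _; exact: GF'.
  by rewrite -E1 {1 2}/F' eqxx setIC muleC.
have sub : <<s [set A | exists2 j, j != i & G j A] >> `<=` <<s H >>.
  apply: smallest_sub; first exact: smallest_sigma_algebra.
  move=> C [j ji GC]; apply: sub_sigma_algebra.
  exists [fset j]%fset, (fun k => if k == j then C else setT); split.
  - by rewrite inE eq_sym.
  - by move=> k; case: eqP => [->|].
  - by rewrite bigcap_fset big_seq_fset1 eqxx.
move=> /sub sA.
have := @g_sigma_algebra_measure_unique _ _ _ H Hm (fun=> setT) (fun=> HT) _
  (mrestr P mB) (mscale (NngNum PB0) P) HI _ _ A sA.
rewrite /= /mrestr /mscale /= fineK// muleC; apply.
- exact: bigcup_const.
- by move=> C HC; rewrite HP// muleC.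
- by move=> _; rewrite setTI ltey_eq PBfin.
Qed.

End Independence.

Lemma rv_eventsT d d' (T : measurableType d) (V : measurableType d') (X : T -> V) :
  rv_events X setT.
Proof. by exists setT. Qed.

Lemma rv_eventsI d d' (T : measurableType d) (V : measurableType d') (X : T -> V) :
  setI_closed (rv_events X).
Proof.
move=> _ _ [A mA ->] [B mB ->]; exists (A `&` B) => //; exact: measurableI.
Qed.

Lemma rv_events_measurable d d' (T : measurableType d) (V : measurableType d')
  (X : T -> V) A : measurable_fun setT X -> rv_events X A -> measurable A.
Proof. by move=> mX [B mB ->]; rewrite -[X in measurable X]setTI; exact: mX. Qed.

(** The types of [V] and [Z] encode their measurability with respect to [H]. Freezing the point at
    which they are evaluated leaves [P (U <= z) - z], which vanishes since [0 < z < 1]. *)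
Lemma uniform_noise_mean0 d (T : measurableType d) (R : realType)
    (P : probability T R) (H : set (set T)) (U : T -> R)
    (V Z : g_sigma_algebraType H -> R) :
  (forall A, <<s H >> A -> measurable A) -> measurable_fun setT U ->
  (forall B, measurable B ->
     P (U @^-1` B) = lebesgue_measure (B `&` `]0%R, 1%R[)) ->
  (forall B A, measurable B -> <<s H >> A ->
     P (U @^-1` B `&` A) = (P (U @^-1` B) * P A)%E) ->
  bounded_rv V -> measurable_fun setT Z -> (forall w, 0 < Z w < 1) ->
  \int[P]_w (V w * ((U w <= Z w)%R%:R - Z w)) = 0.
Proof.
move=> Hm mU PU indepU bV mZ Z01.
pose f (x : R * g_sigma_algebraType H) := V x.2 * ((x.1 <= Z x.2)%R%:R - Z x.2).
apply: (@indep_Rintegral_eq0 _ _ _ T R (g_sigma_algebraType H) R P U id f mU).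
- by move=> _ A mA; rewrite setTI preimage_id; exact: Hm.
- by move=> B A mB mA; rewrite preimage_id; exact: indepU.
- have bZ : bounded_rv Z.
    by split=> //; exists 1 => w; have := Z01 w; rewrite ler_norml; lra.
  have comp2 g : bounded_rv g -> bounded_rv (fun x : R * g_sigma_algebraType H => g x.2).
    by move=> [mg [M hM]]; split; [exact: measurableT_comp|exists M].
  apply: bounded_rvM; first exact: comp2.
  apply: bounded_rvB; last exact: comp2.
  apply: bounded_rv_bool; apply: measurable_fun_ler => //.
  exact: measurableT_comp.
move=> y; rewrite /f /=.
have IE : [set w | U w <= Z y] = U @^-1` `]-oo, Z y].
  by apply/seteqP; split=> w /=; rewrite in_itv.
have mI : measurable [set w | U w <= Z y].
  by rewrite IE -[X in measurable X]setTI; apply: mU.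
have E w : (U w <= Z y)%R%:R = \1_[set w | U w <= Z y] w :> R.
  by rewrite indicE; congr (nat_of_bool _)%:R; apply/idP/idP; rewrite inE.
under eq_Rintegral do rewrite E.
rewrite Rintegral_bounded_rvZ; last by apply: bounded_rvB; [exact: bounded_rv_indic|exact: bounded_rv_cst].
rewrite Rintegral_bounded_rvB; [|exact: bounded_rv_indic|exact: bounded_rv_cst].
rewrite Rintegral_prob_cst Rintegral_indic//.
rewrite IE PU// (_ : _ `&` _ = `]0%R, Z y]%classic); last first.
  have := Z01 y => ?; apply/seteqP; split=> x /=; rewrite !in_itv/=; lra.
by rewrite lebesgue_measure_itv/= lte_fin; have /andP[-> _] := Z01 y; rewrite oppr0 addr0 subrr mulr0.
Qed.

(** * The urn *)

Section ArruMeasurability.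
Context d dS dP (T : measurableType d) (S : measurableType dS)
  (Phi : measurableType dP) (R : realType).
Variables (u : S -> R) (xi1 xi2 : nat -> T -> S) (U : nat -> T -> R)
  (phi : nat -> T -> Phi) (rho1h rho2h : nat -> T -> R) (y10 y20 : R).
Hypothesis u_gt0 : forall s, 0 < u s.
Hypothesis mu : measurable_fun setT u.
Hypotheses (y10_gt0 : 0 < y10) (y20_gt0 : 0 < y20).

Local Notation Y := (arru_Y u xi1 xi2 U rho1h rho2h y10 y20).
Local Notation Y1 := (arru_Y1 u xi1 xi2 U rho1h rho2h y10 y20).
Local Notation Y2 := (arru_Y2 u xi1 xi2 U rho1h rho2h y10 y20).
Local Notation Ytot := (arru_Ytot u xi1 xi2 U rho1h rho2h y10 y20).
Local Notation Z := (arru_Z u xi1 xi2 U rho1h rho2h y10 y20).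
Local Notation X := (arru_X u xi1 xi2 U rho1h rho2h y10 y20).
Local Notation obs := (arru_obs u xi1 xi2 U rho1h rho2h y10 y20).
Local Notation F := (arru_F u xi1 xi2 U rho1h rho2h y10 y20 phi).

Lemma arru_Y1S n w : Y1 n.+1 w = Y1 n w +
  (U n.+1 w <= Z n w)%R%:R * (u (xi1 n.+1 w) * (Z n w <= rho1h n w)%R%:R).
Proof.
rewrite /arru_Z /arru_Ytot /arru_Y1 /arru_Y2 /=; case: (Y n w) => y1 y2 /=.
by case: ifP => [/andP[-> ->]|/nandP[]/negbTE->]; rewrite ?mulr1 ?mul1r ?mulr0 ?mul0r ?addr0.
Qed.

Lemma arru_Y2S n w : Y2 n.+1 w = Y2 n w +
  (~~ (U n.+1 w <= Z n w)%R)%:R * (u (xi2 n.+1 w) * (rho2h n w <= Z n w)%R%:R).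
Proof.
rewrite /arru_Z /arru_Ytot /arru_Y1 /arru_Y2 /=; case: (Y n w) => y1 y2 /=.
by case: ifP => [/andP[-> ->]|/nandP[]/negbTE->]; rewrite ?mulr1 ?mul1r ?mulr0 ?mul0r ?addr0.
Qed.

Lemma arru_Y1_ge n w : y10 <= Y1 n w.
Proof.
elim: n => [//|n IH]; rewrite arru_Y1S (le_trans IH)// lerDl.
by rewrite !mulr_ge0// ltW.
Qed.

Lemma arru_Y2_ge n w : y20 <= Y2 n w.
Proof.
elim: n => [//|n IH]; rewrite arru_Y2S (le_trans IH)// lerDl.
by rewrite !mulr_ge0// ltW.
Qed.

Lemma arru_Y1_gt0 n w : 0 < Y1 n w.
Proof. exact: lt_le_trans (arru_Y1_ge n w). Qed.

Lemma arru_Y2_gt0 n w : 0 < Y2 n w.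
Proof. exact: lt_le_trans (arru_Y2_ge n w). Qed.

Lemma arru_Ytot_ge n w : y10 + y20 <= Ytot n w.
Proof. by rewrite lerD ?arru_Y1_ge ?arru_Y2_ge. Qed.

Lemma arru_Ytot_gt0 n w : 0 < Ytot n w.
Proof. by rewrite addr_gt0 ?arru_Y1_gt0 ?arru_Y2_gt0. Qed.

Lemma arru_Z_itv n w : 0 < Z n w < 1.
Proof.
rewrite divr_gt0 ?arru_Y1_gt0 ?arru_Ytot_gt0//=.
by rewrite ltr_pdivrMr ?arru_Ytot_gt0// mul1r ltrDl arru_Y2_gt0.
Qed.

Hypothesis rho1F : forall n B, measurable B -> F n (rho1h n @^-1` B).
Hypothesis rho2F : forall n B, measurable B -> F n (rho2h n @^-1` B).

Variables (H : set (set T)) (n : nat).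
Local Notation TH := (g_sigma_algebraType H).
Hypothesis mxi1 : forall j, measurable_fun setT (xi1 j : TH -> S).
Hypothesis mxi2 : forall j, measurable_fun setT (xi2 j : TH -> S).
Hypothesis mphi : forall j, measurable_fun setT (phi j : TH -> Phi).
Hypothesis mU : forall j, (j <= n)%N -> measurable_fun setT (U j : TH -> R).

Let mH (V : TH -> R) : measurable_fun setT V <->
  forall B, measurable B -> <<s H >> (V @^-1` B).
Proof.
split=> [mV B mB|mV _ B mB]; first by rewrite -[X in <<s H >> X]setTI; exact: mV.
by rewrite setTI; exact: mV.
Qed.

Let mZ j : measurable_fun setT (Y1 j : TH -> R) ->
  measurable_fun setT (Y2 j : TH -> R) -> measurable_fun setT (Z j : TH -> R).
Proof.
move=> m1 m2; apply: measurable_funM => //.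
apply: measurable_fun_invr => [w|]; last exact: measurable_funD.
by rewrite gt_eqF// arru_Ytot_gt0.
Qed.

Let mF j : (j <= n)%N ->
  (forall i, (i < j)%N -> measurable_fun setT (Z i : TH -> R)) ->
  F j `<=` <<s H >>.
Proof.
move=> jn mZj; apply: smallest_sub; first exact: smallest_sigma_algebra.
have mX i : (i <= j)%N -> measurable_fun setT (X i : TH -> R).
  case: i => [_|i ij]; first exact: measurable_cst.
  apply: (bounded_rv_bool _ _).1.
  by apply: measurable_fun_ler; [apply: mU; exact: leq_trans ij jn|exact: mZj].
move=> A [[i [/andP[i1 ij] [[B mB ->]|[B mB ->]]]]|[i [ij [B mB ->]]]].
- by apply: (mH _).1 => //; exact: mX.
- have : measurable_fun setT (obs i : TH -> S).
    apply: measurable_fun_ifT => //; apply: measurable_fun_eqr => //.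
    exact: mX.
  by move=> /(_ measurableT B mB); rewrite setTI.
- by have := @mphi i measurableT B mB; rewrite setTI.
Qed.

(** Strong induction resolves a circularity: [rho1h j] is measurable for [F j], which is generated
    by draws up to time [j], hence by [Z i] with [i < j], hence by earlier thresholds. The ambient
    [H] is only asked to contain every [xi] and [phi], and [U] up to time [n]. *)
Lemma arru_adapted j : (j <= n)%N ->
  [/\ measurable_fun setT (Y1 j : TH -> R), measurable_fun setT (Y2 j : TH -> R),
      measurable_fun setT (Z j : TH -> R), measurable_fun setT (rho1h j : TH -> R) &
      measurable_fun setT (rho2h j : TH -> R)].
Proof.
elim/ltn_ind: j => j IH jn.
have mFj : F j `<=` <<s H >>.
  by apply: mF => // i ij; have [] := IH i ij (ltnW (leq_trans ij jn)).
have mr1 : measurable_fun setT (rho1h j : TH -> R) by apply/mH => B /rho1F/mFj.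
have mr2 : measurable_fun setT (rho2h j : TH -> R) by apply/mH => B /rho2F/mFj.
suff [m1 m2] : measurable_fun setT (Y1 j : TH -> R) /\ measurable_fun setT (Y2 j : TH -> R).
  by split=> //; exact: mZ.
case: j IH jn {mFj mr1 mr2} => [_ _|j IH jn].
  by split; exact: measurable_cst.
have [m1 m2 mZ' mr1 mr2] := IH j (ltnSn j) (ltnW jn).
split.
  rewrite (_ : Y1 j.+1 = fun w => Y1 j w + (U j.+1 w <= Z j w)%R%:R *
     (u (xi1 j.+1 w) * (Z j w <= rho1h j w)%R%:R)); last first.
    by apply/funext => w; exact: arru_Y1S.
  apply: measurable_funD => //; apply: measurable_funM.
    by apply: (bounded_rv_bool _ _).1; apply: measurable_fun_ler => //; exact: mU.
  apply: measurable_funM; first exact: measurableT_comp.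
  by apply: (bounded_rv_bool _ _).1; exact: measurable_fun_ler.
rewrite (_ : Y2 j.+1 = fun w => Y2 j w + (~~ (U j.+1 w <= Z j w)%R)%:R *
     (u (xi2 j.+1 w) * (rho2h j w <= Z j w)%R%:R)); last first.
  by apply/funext => w; exact: arru_Y2S.
apply: measurable_funD => //; apply: measurable_funM.
  apply: (bounded_rv_bool _ _).1; apply: measurable_neg.
  by apply: measurable_fun_ler => //; exact: mU.
apply: measurable_funM; first exact: measurableT_comp.
by apply: (bounded_rv_bool _ _).1; exact: measurable_fun_ler.
Qed.

End ArruMeasurability.

(** * Passage from sub-sigma-algebras, laws and second moments *)

Lemma measurable_fun_sub_sigma d d' (T : measurableType d) (V : measurableType d')
    (H : set (set T)) (f : g_sigma_algebraType H -> V) :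
  (forall A, <<s H >> A -> measurable A) ->
  measurable_fun setT f -> measurable_fun setT (f : T -> V).
Proof.
by move=> Hm mf _ B mB; rewrite setTI; apply: Hm; rewrite -[X in <<s H >> X]setTI; exact: mf.
Qed.

Lemma bounded_rv_sub_sigma d (T : measurableType d) (R : realType)
    (H : set (set T)) (f : g_sigma_algebraType H -> R) :
  (forall A, <<s H >> A -> measurable A) -> bounded_rv f -> bounded_rv (f : T -> R).
Proof. by move=> Hm [mf bf]; split=> //; exact: measurable_fun_sub_sigma mf. Qed.

Lemma Rintegral_law d d' (T : measurableType d) (S : measurableType d') (R : realType)
    (P : probability T R) (mu : probability S R) (X : T -> S) (f : S -> R) :
  measurable_fun setT X -> (forall B, measurable B -> P (X @^-1` B) = mu B) ->
  bounded_rv f -> \int[P]_w f (X w) = \int[mu]_x f x.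
Proof.
move=> mX PX [mf [M hM]].
pose X' : {mfun T >-> S} := HB.pack X (isMeasurableFun.Build _ _ _ _ _ mX).
have bfX : bounded_rv (f \o X') by split; [exact: (measurableT_comp mf mX)|exists M => w; exact: hM].
rewrite /Rintegral; congr fine.
rewrite [RHS](eq_measure_integral (distribution P X')); last first.
  by move=> A mA _; exact/esym/PX.
rewrite integral_distribution//; first exact/measurable_EFinP.
exact: (bounded_rv_integrable P bfX).
Qed.

Lemma Rintegral_sqr_sum d (T : measurableType d) (R : realType)
    (P : probability T R) (C : nat -> T -> R) (b : R) k :
  (forall i, bounded_rv (C i)) -> (forall i w, `|C i w| <= b) ->
  (forall i j, (i < j)%N -> \int[P]_w (C i w * C j w) = 0) ->
  \int[P]_w (\sum_(i < k) C i w) ^+ 2 <= k%:R * b ^+ 2.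
Proof.
move=> bC Cb C0; elim: k => [|k IH].
  under eq_Rintegral do rewrite big_ord0 expr0n.
  by rewrite Rintegral_prob_cst mul0r.
pose s w := \sum_(i < k) C i w.
have bs : bounded_rv s by apply: bounded_rv_sum.
under eq_Rintegral => w _.
  rewrite big_ord_recr/= -/(s w).
  have -> : (s w + C k w) ^+ 2 = s w ^+ 2 + (2 * \sum_(i < k) (C i w * C k w) + C k w ^+ 2).
    by rewrite -mulr_suml -/(s w); ring.
  over.
have bCC i : bounded_rv (fun w => C i w * C k w) by exact: bounded_rvM.
have bS : bounded_rv (fun w => \sum_(i < k) (C i w * C k w)).
  by apply: (@bounded_rv_sum _ _ _ k (fun i w => C i w * C k w)).
have bsq f : bounded_rv f -> bounded_rv (fun w : T => f w ^+ 2 : R) by move=> bf; exact: bounded_rvM.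
rewrite Rintegral_bounded_rvD; [|exact: bsq|by apply: bounded_rvD; [exact: bounded_rvZ|exact: bsq]].
rewrite Rintegral_bounded_rvD; [|exact: bounded_rvZ|exact: bsq].
rewrite Rintegral_bounded_rvZ// (@Rintegral_bounded_rv_sum _ _ _ P k (fun i w => C i w * C k w))//.
rewrite big1; last by move=> i _; exact: C0.
rewrite mulr0 add0r -[in leRHS]addn1 natrD mulrDl mul1r; apply: lerD => //.
rewrite -[leRHS](Rintegral_prob_cst P); apply: Rintegral_bounded_rv_le; [exact: bsq|exact: bounded_rv_cst|].
move=> w; rewrite -real_normK ?num_real// lerXn2r ?nnegrE//.
exact: le_trans (Cb k w).
Qed.

Lemma measurable_huber_slope (R : realType) (eta : R) :
  measurable_fun setT (huber_slope eta).
Proof.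
apply: measurable_maxr => //; apply: measurable_minr => //.
by apply: measurable_funM.
Qed.

(** * Centring of the noise *)

Section ArruNoise.
Context d dS dP (T : measurableType d) (S : measurableType dS)
  (Phi : measurableType dP) (R : realType) (P : probability T R).
Variables (u : S -> R) (xi1 xi2 : nat -> T -> S) (U : nat -> T -> R)
  (phi : nat -> T -> Phi) (rho1h rho2h : nat -> T -> R) (y10 y20 b : R).
Hypothesis u_gt0 : forall s, 0 < u s.
Hypothesis u_le : forall s, u s <= b.
Hypothesis mu : measurable_fun setT u.
Hypotheses (y10_gt0 : 0 < y10) (y20_gt0 : 0 < y20).
Hypothesis rho1F : forall n B, measurable B ->
  arru_F u xi1 xi2 U rho1h rho2h y10 y20 phi n (rho1h n @^-1` B).
Hypothesis rho2F : forall n B, measurable B ->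
  arru_F u xi1 xi2 U rho1h rho2h y10 y20 phi n (rho2h n @^-1` B).
Hypothesis mxi1 : forall n, measurable_fun setT (xi1 n).
Hypothesis mxi2 : forall n, measurable_fun setT (xi2 n).
Hypothesis mphi : forall n, measurable_fun setT (phi n).
Hypothesis mU : forall n, measurable_fun setT (U n).
Hypothesis PU : forall n B, measurable B ->
  P (U n @^-1` B) = lebesgue_measure (B `&` `]0%R, 1%R[).
Let G := fun k : nat + unit => match k with
      | inl n => rv_events (U n)
      | inr _ => gen_sigma (fun A => exists n,
          rv_events (xi1 n) A \/ rv_events (xi2 n) A \/ rv_events (phi n) A)
      end.
Hypothesis indepU : mutually_independent P G.

Local Notation Y1 := (arru_Y1 u xi1 xi2 U rho1h rho2h y10 y20).
Local Notation Y2 := (arru_Y2 u xi1 xi2 U rho1h rho2h y10 y20).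
Local Notation Ytot := (arru_Ytot u xi1 xi2 U rho1h rho2h y10 y20).
Local Notation Z := (arru_Z u xi1 xi2 U rho1h rho2h y10 y20).

Let GT j : G j setT.
Proof.
case: j => [n|t] /=; first exact: rv_eventsT.
exact: (@measurableT _ (g_sigma_algebraType (fun A => exists n,
          rv_events (xi1 n) A \/ rv_events (xi2 n) A \/ rv_events (phi n) A))).
Qed.

Let GI j : setI_closed (G j).
Proof.
case: j => [n|t] /=; first exact: rv_eventsI.
exact: (@measurableI _ (g_sigma_algebraType (fun A => exists n,
          rv_events (xi1 n) A \/ rv_events (xi2 n) A \/ rv_events (phi n) A))).
Qed.

Let mG j A : G j A -> measurable A.
Proof.
case: j => [n|t] /=; first by apply: rv_events_measurable.
move: A; apply: smallest_sub; first exact: sigma_algebra_measurable.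
by move=> A [n [|[|]]]; apply: rv_events_measurable.
Qed.

(** Everything except [U n.+1], which is more than the past: all the [xi] and [phi] are included.
    The reinforcements of step [n.+1] are thus frozen together with the urn at time [n], and no
    independence between thresholds and reinforcements is called for. *)
Let H n := [set A | exists2 j, j != inl n.+1 & G j A].

Let Hm n A : <<s H n >> A -> measurable A.
Proof.
move: A; apply: smallest_sub; first exact: sigma_algebra_measurable.
by move=> A [j _ /mG].
Qed.

Let Hxi1 n j : measurable_fun setT (xi1 j : g_sigma_algebraType (H n) -> S).
Proof.
move=> _ B mB; rewrite setTI; apply: sub_sigma_algebra; exists (inr tt) => //.
by apply: sub_sigma_algebra; exists j; left; exists B.
Qed.

Let Hxi2 n j : measurable_fun setT (xi2 j : g_sigma_algebraType (H n) -> S).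
Proof.
move=> _ B mB; rewrite setTI; apply: sub_sigma_algebra; exists (inr tt) => //.
by apply: sub_sigma_algebra; exists j; right; left; exists B.
Qed.

Let Hadapted n j : (j <= n)%N ->
  [/\ measurable_fun setT (Y1 j : g_sigma_algebraType (H n) -> R),
      measurable_fun setT (Y2 j : g_sigma_algebraType (H n) -> R),
      measurable_fun setT (Z j : g_sigma_algebraType (H n) -> R),
      measurable_fun setT (rho1h j : g_sigma_algebraType (H n) -> R) &
      measurable_fun setT (rho2h j : g_sigma_algebraType (H n) -> R)].
Proof.
apply: (arru_adapted u_gt0 mu y10_gt0 y20_gt0 rho1F rho2F) => // i.
  move=> _ B mB; rewrite setTI; apply: sub_sigma_algebra; exists (inr tt) => //.
  by apply: sub_sigma_algebra; exists i; right; right; exists B.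
move=> jn _ B mB; rewrite setTI; apply: sub_sigma_algebra; exists (inl i).
  by apply/eqP => -[ij]; move: jn; rewrite ij ltnn.
by exists B.
Qed.

Lemma measurable_arru_Ytot n : measurable_fun setT (Ytot n).
Proof.
have [m1 m2 _ _ _] := Hadapted (leqnn n).
by apply: (measurable_fun_sub_sigma (@Hm n)); exact: measurable_funD.
Qed.

Lemma measurable_arru_Z n : measurable_fun setT (Z n).
Proof.
have [_ _ mZ _ _] := Hadapted (leqnn n).
exact: (measurable_fun_sub_sigma (@Hm n)).
Qed.

Lemma measurable_rho1h n : measurable_fun setT (rho1h n).
Proof.
have [_ _ _ mr _] := Hadapted (leqnn n).
exact: (measurable_fun_sub_sigma (@Hm n)).
Qed.

Lemma arru_noise_mean0 eta rho L delta n i : (n <= i)%N -> 0 < eta ->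
  let N w := ((L <= Ytot n w) && (`|rho - Z n w| <= delta))%R%:R *
    noise eta rho (Y1 i w) (Y2 i w) (u (xi1 i.+1 w) * (Z i w <= rho1h i w)%R%:R)
      (u (xi2 i.+1 w) * (rho2h i w <= Z i w)%R%:R) (U i.+1 w <= Z i w)%R%:R in
  bounded_rv N /\ \int[P]_w N w = 0.
Proof.
move=> ni eta_gt0 N.
have [m1 m2 mZ mr1 mr2] := Hadapted (leqnn i).
have [m1n m2n mZn _ _] := Hadapted ni.
pose V (w : g_sigma_algebraType (H i)) : R :=
  ((L <= Ytot n w) && (`|rho - Z n w| <= delta))%R%:R *
  (huber_slope eta (Z i w - rho) *
  (((1 - Z i w) * (u (xi1 i.+1 w) * (Z i w <= rho1h i w)%R%:R)
    + Z i w * (u (xi2 i.+1 w) * (rho2h i w <= Z i w)%R%:R)) / Ytot i w)).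
have VE w : N w = V w * ((U i.+1 w <= Z i w)%R%:R - Z i w).
  by rewrite /N /V /noise -!mulrA.
have z01 w : 0 <= Z i w <= 1.
  by have /andP[? ?] := arru_Z_itv xi1 xi2 U rho1h rho2h u_gt0 y10_gt0 y20_gt0 i w; rewrite !ltW.
have bZ : bounded_rv (Z i : g_sigma_algebraType (H i) -> R).
  by split=> //; exists 1 => w; rewrite ger0_norm; case/andP: (z01 w).
have bu (X : g_sigma_algebraType (H i) -> S) : measurable_fun setT X -> bounded_rv (u \o X).
  move=> mX; split; first exact: measurableT_comp.
  by exists b => w; rewrite /= gtr0_norm ?u_le.
have bV : bounded_rv V.
  apply: bounded_rvM.
    apply: bounded_rv_bool; apply: measurable_and; apply: measurable_fun_ler => //.
      exact: measurable_funD.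
    by apply: measurableT_comp => //; exact: measurable_funB.
  apply: bounded_rvM.
    split; last first.
      by exists 1 => w; rewrite ler_norml huber_slope_le1.
    apply: measurableT_comp; first exact: measurable_huber_slope.
    exact: measurable_funB.
  apply: bounded_rvM.
    apply: bounded_rvD; apply: bounded_rvM.
    - by apply: bounded_rvB => //; exact: bounded_rv_cst.
    - by apply: bounded_rvM; [exact: bu|apply: bounded_rv_bool; exact: measurable_fun_ler].
    - by [].
    - by apply: bounded_rvM; [exact: bu|apply: bounded_rv_bool; exact: measurable_fun_ler].
  have Yge w : y10 + y20 <= Ytot i w by exact: arru_Ytot_ge.
  have y0 : 0 < y10 + y20 by rewrite addr_gt0.
  split; last first.
    exists (y10 + y20)^-1 => w; rewrite gtr0_norm ?invr_gt0 ?(lt_le_trans y0)//.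
    by rewrite lef_pV2 ?posrE ?(lt_le_trans y0).
  apply: measurable_fun_invr => [w|]; last exact: measurable_funD.
  by rewrite gt_eqF// (lt_le_trans y0).
split.
  rewrite (_ : N = fun w => V w * ((U i.+1 w <= Z i w)%R%:R - Z i w)); last exact/funext.
  apply: bounded_rvM; first exact: (bounded_rv_sub_sigma (@Hm i)).
  apply: bounded_rvB; last exact: (bounded_rv_sub_sigma (@Hm i)).
  by apply: bounded_rv_bool; apply: measurable_fun_ler => //; exact: measurable_arru_Z.
under eq_Rintegral do rewrite VE.
apply: uniform_noise_mean0 => //.
- exact: Hm.
- exact: PU.
- move=> B A mB HA; rewrite setIC muleC.
  by apply: (independent_others indepU GT GI mG (i := inl i.+1)) => //; exists B.
- by move=> w; exact: arru_Z_itv.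
Qed.

End ArruNoise.

(** * The expected increment over a window *)

Lemma norm_le_sqr (R : realType) (x c : R) : 0 < c -> `|x| <= c + x ^+ 2 / c.
Proof.
move=> c0; have [xc|xc] := lerP `|x| c.
  by rewrite (le_trans xc)// lerDl divr_ge0 ?sqr_ge0// ltW.
apply: (@le_trans _ _ (x ^+ 2 / c)); last by rewrite lerDr ltW.
by rewrite ler_pdivlMr// -real_normK ?num_real// expr2 ler_wpM2l// ltW.
Qed.

(** If [Ytot n w < L], the trivial bound [1] is used; if [Delta_n > delta], the left side is zero;
    otherwise [huber_path] is run from time [n]. The term [eta / 2] pays for replacing the norm by
    [huber], and [norm_le_sqr] trades [|s|] for second moments. *)
Lemma arru_increment_le d dS (T : measurableType d) (S : measurableType dS) (R : realType)
    (u : S -> R) (xi1 xi2 : nat -> T -> S) (U : nat -> T -> R)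
    (rho1h rho2h : nat -> T -> R) (y10 y20 b rho m1 m2 eta e L c delta : R)
    (n k : nat) (w : T) :
  (forall s, 0 < u s) -> (forall s, u s <= b) -> 0 < y10 -> 0 < y20 ->
  0 <= rho <= 1 -> m2 <= m1 -> 0 < eta -> 0 < e -> 0 < L -> 0 < c ->
  let Y1 := arru_Y1 u xi1 xi2 U rho1h rho2h y10 y20 in
  let Y2 := arru_Y2 u xi1 xi2 U rho1h rho2h y10 y20 in
  let Ytot := arru_Ytot u xi1 xi2 U rho1h rho2h y10 y20 in
  let Z := arru_Z u xi1 xi2 U rho1h rho2h y10 y20 in
  let s j := \sum_(i < j) (u (xi2 (n + i).+1 w) - m2 - (u (xi1 (n + i).+1 w) - m1)) in
  is_true ((`|rho - Z (n + k)%N w| - `|rho - Z n w|) * (`|rho - Z n w| <= delta)%R%:R <=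
    (Ytot n w < L)%R%:R + eta / 2
    + \sum_(i < k) ((L <= Ytot n w) && (`|rho - Z n w| <= delta))%R%:R *
       noise eta rho (Y1 (n + i)%N w) (Y2 (n + i)%N w)
         (u (xi1 (n + i).+1 w) * (Z (n + i)%N w <= rho1h (n + i)%N w)%R%:R)
         (u (xi2 (n + i).+1 w) * (rho2h (n + i)%N w <= Z (n + i)%N w)%R%:R)
         (U (n + i).+1 w <= Z (n + i)%N w)%R%:R
    + \sum_(i < k) b / L * (e < `|rho1h (n + i)%N w - rho|)%R%:R
    + k%:R * (b / L * (e / eta) + (b / L) ^+ 2 * (1 + eta^-1))
    + \sum_(i < k) b / L ^+ 2 * (eta^-1 + 2) * (c + s i.+1 ^+ 2 / c)
    + L^-1 * (c + s k ^+ 2 / c)).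
Proof.
move=> u0 ub y10p y20p rho01 m12 eta0 e0 L0 c0 Y1 Y2 Ytot Z s.
have Zitv i : 0 < Z i w < 1 by exact: arru_Z_itv.
have b0 : 0 <= b by apply: le_trans (ltW (u0 (xi1 0%N w))) (ub _).
set N := \sum_(i < k) _ * noise _ _ _ _ _ _ _.
set B := \sum_(i < k) _ * _%:R.
set M := k%:R * _.
set Q := \sum_(i < k) _ * (_ + _).
have iL0 : 0 <= L^-1 by rewrite invr_ge0 ltW.
have ie0 : 0 <= eta^-1 by rewrite invr_ge0 ltW.
have sq x : 0 <= c + x ^+ 2 / c by rewrite addr_ge0 ?divr_ge0 ?sqr_ge0// ltW.
have B0 : 0 <= B by apply: sumr_ge0 => i _; rewrite mulr_ge0// mulr_ge0.
have M0 : 0 <= M.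
  rewrite mulr_ge0// addr_ge0// ?mulr_ge0// ?sqr_ge0//; first exact: ltW.
  by rewrite addr_ge0.
have c30 : 0 <= b / L ^+ 2 * (eta^-1 + 2).
  by rewrite mulr_ge0// ?addr_ge0// divr_ge0// sqr_ge0.
have Q0 : 0 <= Q by apply: sumr_ge0 => i _; rewrite mulr_ge0.
have E0 : 0 <= L^-1 * (c + s k ^+ 2 / c) by rewrite mulr_ge0.
have T1 : true%:R = 1 :> R by [].
have T0 : false%:R = 0 :> R by [].
have [hL|hL] := ltP (Ytot n w) L; rewrite ?T1 ?T0.
  have -> : N = 0 by rewrite /N big1// => i _; rewrite leNgt hL mul0r.
  have D1 : `|rho - Z (n + k)%N w| <= 1.
    by have := Zitv (n + k)%N; rewrite ler_norml; lra.
  have : (`|rho - Z (n + k)%N w| - `|rho - Z n w|) * (`|rho - Z n w| <= delta)%R%:R <= 1.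
    have := normr_ge0 (rho - Z n w).
    by case: (`|rho - Z n w| <= delta); rewrite ?mulr1 ?mulr0; lra.
  lra.
have [hd|hd] := boolP (`|rho - Z n w| <= delta); last first.
  have -> : N = 0 by rewrite /N big1// => i _; rewrite (negbTE hd) andbF mul0r.
  by rewrite T0 mulr0; lra.
have h1 := norm_le_huber (Z (n + k)%N w - rho) eta0.
have h2 := huber_le_norm (Z n w - rho) eta0.
rewrite T1 mulr1 !(distrC rho).
have u0b (t : S) : 0 <= u t <= b by rewrite ub ltW.
have Lw : L <= Y1 (n + 0)%N w + Y2 (n + 0)%N w by rewrite addn0.
have Y1S i : Y1 (n + i.+1)%N w = Y1 (n + i)%N w + (U (n + i).+1 w <= Z (n + i)%N w)%R%:R *
  (u (xi1 (n + i).+1 w) * (Z (n + i)%N w <= rho1h (n + i)%N w)%R%:R).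
  by rewrite addnS; exact: arru_Y1S.
have Y2S i : Y2 (n + i.+1)%N w = Y2 (n + i)%N w + (~~ (U (n + i).+1 w <= Z (n + i)%N w)%R)%:R *
  (u (xi2 (n + i).+1 w) * (rho2h (n + i)%N w <= Z (n + i)%N w)%R%:R).
  by rewrite addnS; exact: arru_Y2S.
have m0 : 0 <= m1 - m2 by lra.
have p1 : 0 < Y1 (n + 0)%N w by exact: arru_Y1_gt0.
have p2 : 0 < Y2 (n + 0)%N w by exact: arru_Y2_gt0.
have := @huber_path R eta e rho b L (m1 - m2) (fun i => Y1 (n + i)%N w)
  (fun i => Y2 (n + i)%N w) (fun i => u (xi1 (n + i).+1 w))
  (fun i => u (xi2 (n + i).+1 w)) (fun i => rho1h (n + i)%N w)
  (fun i => U (n + i).+1 w <= Z (n + i)%N w)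
  (fun i => rho2h (n + i)%N w <= Z (n + i)%N w)
  eta0 e0 L0 m0 (fun i => u0b _) (fun i => u0b _)
  p1 p2
  Lw Y1S Y2S k.
rewrite -/Ytot; cbv zeta.
have sE j : \sum_(i < j) (u (xi2 (n + i).+1 w) - u (xi1 (n + i).+1 w) + (m1 - m2)) = s j.
  by apply: eq_bigr => i _; ring.
set N' := \sum_(i < k) noise _ _ _ _ _ _ _.
set B' := \sum_(i < k) _ * _%:R.
set Q' := \sum_(i < k) _ * `|_|.
have NN : N' = N by apply: eq_bigr => i _; rewrite hL hd mul1r.
have BB : B' = B by [].
have QQ : Q' <= Q.
  by apply: ler_sum => i _; rewrite sE; apply: ler_wpM2l => //; exact: norm_le_sqr.
rewrite NN BB -/M sE addn0.
have EE : L^-1 * `|s k| <= L^-1 * (c + s k ^+ 2 / c).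
  by apply: ler_wpM2l => //; exact: norm_le_sqr.
rewrite -/(Z (n + k)%N w) -/(Z n w) => HH; lra.
Qed.

(** Abstract form of the expectation of the pathwise bound: [I] stands for the event of a small
    total, [N] for the noise, [B] for a bad threshold and [s] for the centred partial sums. *)
Lemma Rintegral_increment_le d (T : measurableType d) (R : realType)
    (P : probability T R) (k : nat) (f I : T -> R) (N B s : nat -> T -> R)
    (c0 beta gamma q r c p h v : R) :
  bounded_rv f -> bounded_rv I -> (forall i, bounded_rv (N i)) ->
  (forall i, bounded_rv (B i)) ->
  (forall j, bounded_rv (s j)) -> 0 <= beta -> 0 <= q -> 0 <= r -> 0 < c ->
  (forall w, f w <= I w + c0 + \sum_(i < k) N i w + \sum_(i < k) beta * B i w
    + gamma + \sum_(i < k) q * (c + s i.+1 w ^+ 2 / c) + r * (c + s k w ^+ 2 / c)) ->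
  \int[P]_w I w <= p -> (forall i, \int[P]_w N i w = 0) ->
  (forall i, \int[P]_w B i w <= h) ->
  (forall j, (j <= k)%N -> \int[P]_w (s j w ^+ 2) <= v) ->
  \int[P]_w f w <= p + c0 + k%:R * (beta * h) + gamma + k%:R * (q * (c + v / c))
    + r * (c + v / c).
Proof.
move=> bf bI bN bB bs beta0 q0 r0 c_gt0 fle Ip N0 Bh sv.
have bc (x : R) : bounded_rv (fun _ : T => x) by exact: bounded_rv_cst.
have bs2 j : bounded_rv (fun w => s j w ^+ 2) by exact: bounded_rvM.
have bsc j : bounded_rv (fun w => c + s j w ^+ 2 / c).
  by apply: bounded_rvD => //; apply: bounded_rvM.
have Esc j : (j <= k)%N -> \int[P]_w (c + s j w ^+ 2 / c) <= c + v / c.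
  move=> jk; rewrite Rintegral_bounded_rvD//; last exact: bounded_rvM.
  rewrite Rintegral_prob_cst lerD2l.
  under eq_Rintegral do rewrite mulrC.
  by rewrite Rintegral_bounded_rvZ// mulrC ler_wpM2r ?sv// invr_ge0 ltW.
have bN' : bounded_rv (fun w => \sum_(i < k) N i w) by exact: bounded_rv_sum.
have bB' : bounded_rv (fun w => \sum_(i < k) beta * B i w).
  by apply: (@bounded_rv_sum _ _ _ k (fun i w => beta * B i w)) => i _; exact: bounded_rvZ.
have bq' : bounded_rv (fun w => \sum_(i < k) q * (c + s i.+1 w ^+ 2 / c)).
  by apply: (@bounded_rv_sum _ _ _ k (fun i w => q * (c + s i.+1 w ^+ 2 / c))) => i _; exact: bounded_rvZ.
have br' : bounded_rv (fun w => r * (c + s k w ^+ 2 / c)) by exact: bounded_rvZ.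
have b1 := bounded_rvD bI (bc c0).
have b2 := bounded_rvD b1 bN'.
have b3 := bounded_rvD b2 bB'.
have b4 := bounded_rvD b3 (bc gamma).
have b5 := bounded_rvD b4 bq'.
have b6 := bounded_rvD b5 br'.
apply: le_trans (Rintegral_bounded_rv_le P bf b6 fle) _.
rewrite (Rintegral_bounded_rvD P b5 br') (Rintegral_bounded_rvD P b4 bq').
rewrite (Rintegral_bounded_rvD P b3 (bc gamma)) (Rintegral_bounded_rvD P b2 bB').
rewrite (Rintegral_bounded_rvD P b1 bN') (Rintegral_bounded_rvD P bI (bc c0)).
rewrite !Rintegral_prob_cst.
rewrite (Rintegral_bounded_rv_sum P (fun i _ => bN i)) big1; last by move=> i _; exact: N0.
rewrite (@Rintegral_bounded_rv_sum _ _ _ P k (fun i w => beta * B i w)); last first.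
  by move=> i _; exact: bounded_rvZ.
rewrite (@Rintegral_bounded_rv_sum _ _ _ P k (fun i w => q * (c + s i.+1 w ^+ 2 / c))); last first.
  by move=> i _; exact: bounded_rvZ.
rewrite Rintegral_bounded_rvZ// addr0.
have sumk (x : R) : k%:R * x = \sum_(i < k) x by rewrite sumr_const card_ord mulr_natl.
apply: lerD; last by apply: ler_wpM2l => //; exact: Esc.
apply: lerD.
  rewrite lerD2r; apply: lerD; first by rewrite lerD2r.
  rewrite sumk; apply: ler_sum => i _.
  by rewrite Rintegral_bounded_rvZ//; apply: ler_wpM2l.
rewrite sumk; apply: ler_sum => i _.
rewrite Rintegral_bounded_rvZ//; apply: ler_wpM2l => //.
by apply: Esc.
Qed.

(** With [kx = t * x] the left side equals [g t], which increases with [t <= K]. The result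
    separates terms small with [eta], terms small with [lam] once [eta] is fixed, and terms of order
    [1 / x]. *)
Lemma increment_bound_le (R : realType) (b c K eta lam B p x kx : R) :
  0 <= b -> 0 < c -> 0 < eta -> 0 < lam -> 0 <= B -> 0 < x -> 0 <= kx -> kx <= K * x ->
  p + eta / 2 + kx * (b / (c * x) * eta)
    + kx * (b / (c * x) * (eta ^+ 2 / eta) + (b / (c * x)) ^+ 2 * (1 + eta^-1))
    + kx * (b / (c * x) ^+ 2 * (eta^-1 + 2) * (lam * x + kx * B / (lam * x)))
    + (c * x)^-1 * (lam * x + kx * B / (lam * x)) <=
  p + eta * (2^-1 + 2 * K * b / c) + lam * (c^-1 + K * b / c ^+ 2 * (eta^-1 + 2))
    + (K * (b / c) ^+ 2 * (1 + eta^-1)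
       + (K * b / c ^+ 2 * (eta^-1 + 2) + c^-1) * (K * B / lam)) / x.
Proof.
move=> b0 c0 e0 l0 B0 x0 k0 kK.
pose t := kx / x.
have tx : kx = t * x by rewrite /t divfK// gt_eqF.
have t0 : 0 <= t by rewrite divr_ge0// ltW.
have tK : t <= K by rewrite /t ler_pdivrMr.
have K0 : 0 <= K by exact: le_trans tK.
pose g (t : R) := p + eta * (2^-1 + 2 * t * b / c)
   + lam * (c^-1 + t * b / c ^+ 2 * (eta^-1 + 2))
    + (t * (b / c) ^+ 2 * (1 + eta^-1)
       + (t * b / c ^+ 2 * (eta^-1 + 2) + c^-1) * (t * B / lam)) / x.
rewrite -/(g K); apply: (@le_trans _ _ (g t)).
  rewrite le_eqVlt; apply/orP; left; apply/eqP.
  by rewrite tx /g; field; rewrite !gt_eqF.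
have ie : 0 <= eta^-1 by rewrite invr_ge0 ltW.
have ic : 0 <= c^-1 by rewrite invr_ge0 ltW.
have ic2 : 0 <= (c ^+ 2)^-1 by rewrite invr_ge0 sqr_ge0.
have il : 0 <= lam^-1 by rewrite invr_ge0 ltW.
have ix : 0 <= x^-1 by rewrite invr_ge0 ltW.
have e2 : 0 <= eta^-1 + 2 by rewrite addr_ge0.
have tb : t * b <= K * b by rewrite ler_wpM2r.
have tbc : t * b / c ^+ 2 * (eta^-1 + 2) <= K * b / c ^+ 2 * (eta^-1 + 2).
  by do 2 apply: ler_wpM2r => //.
rewrite /g; apply: lerD; [apply: lerD; [rewrite lerD2l|]|].
- apply: ler_wpM2l; first exact: ltW.
  by rewrite lerD2l; apply: ler_wpM2r => //; lra.
- by apply: ler_wpM2l; [exact: ltW|rewrite lerD2l].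
apply: ler_wpM2r => //; apply: lerD.
  apply: ler_wpM2r; first by rewrite addr_ge0.
  by apply: ler_wpM2r; rewrite ?sqr_ge0.
apply: ler_pM.
- by rewrite addr_ge0// !mulr_ge0.
- by rewrite !mulr_ge0.
- by rewrite lerD2r.
- by do 2 apply: ler_wpM2r => //.
Qed.

(** * Choice of constants and conclusion *)

Lemma limn_esup_le0 (R : realType) (f : nat -> \bar R) :
  (forall e : R, 0 < e -> \forall n \near \oo, (f n <= e%:E)%E) ->
  (limn_esup f <= 0)%E.
Proof.
move=> fe; apply/lee_addgt0Pr => e e0; rewrite add0e.
have [N _ Nf] := fe e e0.
rewrite limn_esup_lim; apply: lime_le; first exact: is_cvg_esups.
exists N => // n /= Nn; apply: ge_ereal_sup => _ [m /= nm <-].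
by apply: Nf => /=; exact: leq_trans nm.
Qed.

Theorem theorem4p4
  (R : realType) (d dS dP : measure_display)
  (T : measurableType d) (S : measurableType dS) (Phi : measurableType dP)
  (P : probability T R)
  (a b : R) (u : S -> R) (mu1 mu2 : probability S R)
  (xi1 xi2 : nat -> T -> S) (U : nat -> T -> R) (phi : nat -> T -> Phi)
  (rho1h rho2h : nat -> T -> R) (y10 y20 : R)
  (rho_min rho_max c_rho rho1 rho2 c1 C1 eps_y : R) :
  (* reinforcement function *)
  0 < a -> a <= b -> measurable_fun setT u ->
  (forall s, a <= u s <= b) ->
  (* xi's: independent i.i.d. sequences with laws mu1, mu2 *)
  (forall n, measurable_fun setT (xi1 n)) ->
  (forall n, measurable_fun setT (xi2 n)) ->
  mutually_independent P
    (fun k : nat + nat => match k with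
                          | inl n => rv_events (xi1 n)
                          | inr n => rv_events (xi2 n) end) ->
  (forall n B, measurable B -> P (xi1 n @^-1` B) = mu1 B) ->
  (forall n B, measurable B -> P (xi2 n @^-1` B) = mu2 B) ->
  (* auxiliary variables *)
  (forall n, measurable_fun setT (phi n)) ->
  (* U's: i.i.d. uniform on (0,1), independent of the xi's and phi's *)
  (forall n, measurable_fun setT (U n)) ->
  (forall n B, measurable B ->
     P (U n @^-1` B) = lebesgue_measure (B `&` `]0%R, 1%R[)) ->
  mutually_independent P
    (fun k : nat + unit => match k with
      | inl n => rv_events (U n)
      | inr _ => gen_sigma (fun A => exists n,
          rv_events (xi1 n) A \/ rv_events (xi2 n) A \/ rv_events (phi n) A)
      end) ->
  (* initial composition *)
  0 < y10 -> 0 < y20 ->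
  (* thresholds: [0,1]-valued, ordered, F_n-measurable *)
  (forall n w, 0 <= rho2h n w <= rho1h n w /\ rho1h n w <= 1) ->
  (forall n B, measurable B ->
     arru_F u xi1 xi2 U rho1h rho2h y10 y20 phi n (rho1h n @^-1` B)) ->
  (forall n B, measurable B ->
     arru_F u xi1 xi2 U rho1h rho2h y10 y20 phi n (rho2h n @^-1` B)) ->
  (* m1 > m2 *)
  (\int[mu2]_x (u x)%:E < \int[mu1]_x (u x)%:E)%E ->
  (* exponential concentration of the thresholds *)
  0 < rho_min -> rho_min <= rho_max -> rho_max < 1 -> 0 < c_rho ->
  (\forall n \near \oo,
     (1 - expR (- (c_rho * n%:R)))%:E <=
     P [set w | (rho_min <= rho2h n w /\ rho2h n w <= rho1h n w /\
                rho1h n w <= rho_max)%R])%E ->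
  (* limits in probability of the thresholds *)
  0 < rho2 -> rho2 <= rho1 -> rho1 < 1 ->
  cvg_in_prob P rho1h rho1 -> cvg_in_prob P rho2h rho2 ->
  (* linear growth of Y_n with exponential probability *)
  0 < c1 -> 0 < eps_y ->
  (\forall n \near \oo,
     (1 - expR (- (eps_y * n%:R)))%:E <=
     P [set w | (y10 + y20 + c1 * n%:R <=
                  arru_Ytot u xi1 xi2 U rho1h rho2h y10 y20 n w /\
                arru_Ytot u xi1 xi2 U rho1h rho2h y10 y20 n w <=
                  y10 + y20 + C1 * n%:R)%R])%E ->
  forall (delta s : R), 0 < delta ->
    0 < s -> s < expR (c1 / (2 * b) * delta) - 1 ->
    let Delta n w :=
      `|rho1 - arru_Z u xi1 xi2 U rho1h rho2h y10 y20 n w| in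
    let k n := Num.truncn (n%:R * s + 2^-1) in
    (limn_esup (fun n : nat =>
       \int[P]_w ((Delta (n + k n)%N w - Delta n w) *
                  \1_[set w' | (Delta n w' <= delta)%R] w)%:E) <= 0)%E.

Proof.
move=> a0 ab mu ub mxi1 mxi2 indxi law1 law2 mphi mU PU indU y1p y2p _ rF1 rF2
  m12 _ _ _ _ _ r2p r21 r11 cv1 _ c1p epsp Yconc delta s delta0 s0 _; cbv zeta.
pose Z := arru_Z u xi1 xi2 U rho1h rho2h y10 y20.
pose Delta n w := `|rho1 - Z n w|.
pose k n := Num.truncn (n%:R * s + 2^-1).
have u0 t : 0 < u t by have := ub t; lra.
have ule t : u t <= b by have := ub t; lra.
have b0 : 0 <= b by lra.
have bu : bounded_rv u by split=> //; exists b => t; rewrite gtr0_norm.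
pose m1 := \int[mu1]_x u x; pose m2 := \int[mu2]_x u x.
have m21 : m2 <= m1.
  by rewrite -lee_fin /m1 /m2 !EFin_Rintegral_bounded_rv// ltW.
have mean01 (nu : probability S R) : 0 <= \int[nu]_x u x <= b.
  rewrite Rintegral_ge0/=; last by move=> x _; exact: ltW.
  by rewrite -[leRHS](Rintegral_prob_cst nu); apply: Rintegral_bounded_rv_le => //; exact: bounded_rv_cst.
(* One family for both sequences, so that a single covariance computation covers equal and different
   colours. *)
pose xs (p : nat + nat) : T -> S := match p with inl n => xi1 n | inr n => xi2 n end.
pose ms (p : nat + nat) := if p is inl _ then m1 else m2.
have mxs p : measurable_fun setT (xs p) by case: p.
have indxs : mutually_independent P (fun p => rv_events (xs p)).
  rewrite (_ : (fun p => _) = fun p : nat + nat => match p with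
    | inl n => rv_events (xi1 n) | inr n => rv_events (xi2 n) end)//.
  by apply/funext; case.
have msE p : \int[P]_w u (xs p w) = ms p.
  by case: p => n; rewrite /xs /ms; [rewrite (Rintegral_law _ (law1 n))|rewrite (Rintegral_law _ (law2 n))].
have buxs p : bounded_rv (fun w => u (xs p w)).
  by split; [exact: measurableT_comp|exists b => w; rewrite gtr0_norm].
have cov p q : p != q -> \int[P]_w ((u (xs p w) - ms p) * (u (xs q w) - ms q)) = 0.
  move=> pq.
  apply: (@indep_Rintegral_eq0 _ _ _ T S S R P (xs p) (xs q)
    (fun x => (u x.1 - ms p) * (u x.2 - ms q))) => //.
  - by move=> A B mA mB; apply: (independent_pair indxs pq); [exists A|exists B].
  - have bu1 : bounded_rv (fun x : S * S => u x.1).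
      by split; [exact: measurableT_comp|exists b => x; rewrite gtr0_norm].
    have bu2 : bounded_rv (fun x : S * S => u x.2).
      by split; [exact: measurableT_comp|exists b => x; rewrite gtr0_norm].
    by apply: bounded_rvM; apply: bounded_rvB => //; exact: bounded_rv_cst.
  move=> y /=; under eq_Rintegral do rewrite mulrC.
  rewrite Rintegral_bounded_rvZ; last by apply: bounded_rvB => //; exact: bounded_rv_cst.
  by rewrite Rintegral_bounded_rvB// ?Rintegral_prob_cst ?msE ?subrr ?mulr0//; exact: bounded_rv_cst.
pose C i w := u (xi2 i w) - m2 - (u (xi1 i w) - m1).
have bC i : bounded_rv (C i).
  apply: bounded_rvB; apply: bounded_rvB; try exact: bounded_rv_cst; [exact: (buxs (inr i))|exact: (buxs (inl i))].
have Cb i w : `|C i w| <= 2 * b.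
  have := ub (xi1 i w); have := ub (xi2 i w); have := mean01 mu1; have := mean01 mu2.
  by rewrite -/m1 -/m2 /C ler_norml; lra.
have C0 i j : (i < j)%N -> \int[P]_w (C i w * C j w) = 0.
  move=> ij.
  have bc p q : bounded_rv (fun w => (u (xs p w) - ms p) * (u (xs q w) - ms q)).
    by apply: bounded_rvM; apply: bounded_rvB => //; exact: bounded_rv_cst.
  have ne (h : nat -> nat + nat) : injective h -> h i != h j.
    by move=> hI; rewrite (inj_eq hI) ltn_eqF.
  rewrite (_ : (fun w => _) = fun w =>
    ((u (xs (inr i) w) - ms (inr i)) * (u (xs (inr j) w) - ms (inr j)) -
     (u (xs (inr i) w) - ms (inr i)) * (u (xs (inl j) w) - ms (inl j))) -
    ((u (xs (inl i) w) - ms (inl i)) * (u (xs (inr j) w) - ms (inr j)) -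
     (u (xs (inl i) w) - ms (inl i)) * (u (xs (inl j) w) - ms (inl j)))); last first.
    by apply/funext => w; rewrite /C /xs /ms; ring.
  rewrite Rintegral_bounded_rvB; [|exact: bounded_rvB|exact: bounded_rvB].
  rewrite !Rintegral_bounded_rvB// !cov ?subrr//; by rewrite ne// => ? ? [].
have sq n kk : \int[P]_w (\sum_(i < kk) C (n + i).+1 w) ^+ 2 <= kk%:R * (2 * b) ^+ 2.
  apply: (@Rintegral_sqr_sum _ T R P (fun i => C (n + i).+1)) => // i j ij.
  by apply: C0; rewrite ltnS ltn_add2l.
have mYt := measurable_arru_Ytot u0 mu y1p y2p rF1 rF2 mxi1 mxi2 mphi mU.
have mZ := measurable_arru_Z u0 mu y1p y2p rF1 rF2 mxi1 mxi2 mphi mU.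
have mr1 := measurable_rho1h u0 mu y1p y2p rF1 rF2 mxi1 mxi2 mphi mU.
have Zitv n w := arru_Z_itv xi1 xi2 U rho1h rho2h u0 y1p y2p n w.
have bZ n : bounded_rv (arru_Z u xi1 xi2 U rho1h rho2h y10 y20 n).
  split; first exact: mZ.
  by exists 1 => w; have := Zitv n w; rewrite ler_norml; lra.
have bDelta n : bounded_rv (Delta n).
  by apply: bounded_rv_normr; apply: bounded_rvB => //; exact: bounded_rv_cst.
apply: limn_esup_le0 => eps eps0.
(* The window has at most [n s + 1 / 2 <= K n] steps when [n >= 1]. *)
pose K := s + 1.
pose kb := 2^-1 + 2 * K * b / c1.
have kb0 : 0 <= kb.
  by rewrite /kb addr_ge0// divr_ge0 ?(ltW c1p)// mulr_ge0// mulr_ge0// /K; lra.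
(* Error budget: [eps / 4] for the [eta] terms, [eps / 4] for the [lam] terms and [eps / 2] for
   those of order [1 / n]. The coefficient [kl] contains [eta^-1], so [lam] comes after [eta]. *)
pose eta := eps / (4 * (1 + kb)).
have eta0 : 0 < eta by rewrite /eta divr_gt0//; lra.
pose kl := c1^-1 + K * b / c1 ^+ 2 * (eta^-1 + 2).
have kl0 : 0 <= kl.
  rewrite /kl addr_ge0 ?invr_ge0 ?(ltW c1p)// mulr_ge0// ?addr_ge0 ?invr_ge0 ?(ltW eta0)//.
  by rewrite divr_ge0 ?sqr_ge0// mulr_ge0// /K; lra.
pose lam := eps / (4 * (1 + kl)).
have lam0 : 0 < lam by rewrite /lam divr_gt0//; lra.
pose be := K * (b / c1) ^+ 2 * (1 + eta^-1)
       + (K * b / c1 ^+ 2 * (eta^-1 + 2) + c1^-1) * (K * (2 * b) ^+ 2 / lam).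
have mbad n : measurable [set w | eta ^+ 2 < `|rho1h n w - rho1|].
  have bh : measurable_fun setT (fun w => eta ^+ 2 < `|rho1h n w - rho1|).
    apply: measurable_fun_ltr => //; apply: measurableT_comp => //.
    exact: measurable_funB.
  by have := bh measurableT [set true] I; rewrite setTI.
(* The bound holds at every time from [N2] on, so at each time [n + i] of the window. *)
have [N2 _ hN2] : \forall n \near \oo, fine (P [set w | eta ^+ 2 < `|rho1h n w - rho1|]) <= eta.
  have := cv1 (eta ^+ 2) (exprn_gt0 _ eta0).
  move=> /fine_cvgP[_ /cvgrPdist_le /(_ eta eta0)].
  apply: filterS => n /=; rewrite sub0r normrN; apply: le_trans; exact: ler_norm.
near=> n.
have n1 : (0 < n)%N by near: n; exact: nbhs_infty_gt.
have n2 : (N2 <= n)%N by near: n; exact: nbhs_infty_ge.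
have n3 : (eps_y^-1 + be) / (eps / 2) <= n%:R by near: n; exact: nbhs_infty_ger.
set x : R := n%:R.
have x0 : 0 < x by rewrite ltr0n.
have kK : (k n)%:R <= K * x.
  have h : 0 <= x * s + 2^-1 by rewrite addr_ge0 ?mulr_ge0 ?ltW.
  apply: (@le_trans _ _ (x * s + 2^-1)); first by rewrite /k truncn_le.
  have : 1 <= x by rewrite /x ler1n.
  rewrite /K; lra.
pose Yt := arru_Ytot u xi1 xi2 U rho1h rho2h y10 y20.
have mlow : measurable [set w | Yt n w < c1 * x].
  have bh : measurable_fun setT (fun w => Yt n w < c1 * x).
    apply: measurable_fun_ltr => //; exact: mYt.
  by have := bh measurableT [set true] I; rewrite setTI.
(* The exponential tail is weakened to [1 / (eps_y n)], by [1 + t <= expR t], to merge with the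
   other terms of order [1 / n]. *)
have Plow : fine (P [set w | Yt n w < c1 * x]) <= eps_y^-1 / x.
  have mgood : measurable [set w | (y10 + y20 + c1 * n%:R <= Yt n w /\
      Yt n w <= y10 + y20 + C1 * n%:R)%R].
    have bh : measurable_fun setT (fun w => (y10 + y20 + c1 * n%:R <= Yt n w) &&
        (Yt n w <= y10 + y20 + C1 * n%:R)).
      by apply: measurable_and; apply: measurable_fun_ler => //; exact: mYt.
    have := bh measurableT [set true] I; rewrite setTI.
    by congr measurable; apply/seteqP; split => w /= /andP.
  have : ((1 - expR (- (eps_y * n%:R)))%:E <= P [set w | (y10 + y20 + c1 * n%:R <= Yt n w /\
      Yt n w <= y10 + y20 + C1 * n%:R)%R])%E.
    by near: n.
  set Gd := [set w | _ /\ _] in mgood *.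
  move=> PG.
  have : (P [set w | (Yt n w < c1 * x)%R] <= 1 - P Gd)%E.
    rewrite -probability_setC//; apply: le_measure; rewrite ?inE//.
      exact: measurableC.
    by move=> w /= h [h1 _]; have : c1 * n%:R = c1 * x by []; lra.
  move: PG; rewrite -(fineK (fin_num_measure P _ mgood)) -(fineK (fin_num_measure P _ mlow)).
  rewrite -EFinB !lee_fin => PG PL.
  apply: le_trans PL _; apply: (@le_trans _ _ (expR (- (eps_y * x)))); first by rewrite /x; lra.
  rewrite expRN -invfM lef_pV2 ?posrE ?mulr_gt0 ?expR_gt0//.
  by apply: le_trans (expR_ge1Dx _); lra.
have bbool (h : T -> bool) (A : set T) : measurable A -> A = [set w | h w] ->
    bounded_rv (fun w => (h w)%:R : R) /\ \int[P]_w (h w)%:R = fine (P A).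
  move=> mA hA; have -> : (fun w => (h w)%:R : R) = \1_A.
    by apply/funext => w; rewrite hA indicE; congr (nat_of_bool _)%:R; apply/idP/idP; rewrite inE.
  by split; [exact: bounded_rv_indic|exact: Rintegral_indic].
have [bI EI] := bbool (fun w => Yt n w < c1 * x) _ mlow erefl.
pose f w := (`|rho1 - Z (n + k n)%N w| - `|rho1 - Z n w|) * (`|rho1 - Z n w| <= delta)%R%:R.
have bf : bounded_rv f.
  apply: bounded_rvM; first by apply: (bounded_rvB (bDelta _) (bDelta _)).
  by apply: bounded_rv_bool; apply: measurable_fun_ler => //; have [] := bDelta n.
have -> : (\int[P]_w ((`|rho1 - Z (n + k n)%N w| - `|rho1 - Z n w|) *
      \1_[set w' | `|rho1 - Z n w'| <= delta] w)%:E)%E = (\int[P]_w f w)%:E.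
  rewrite EFin_Rintegral_bounded_rv//; apply: eq_integral => w _; congr (_ * _)%:E.
  by rewrite indicE; congr (nat_of_bool _)%:R; apply/idP/idP; rewrite inE.
rewrite lee_fin.
have L0 : 0 < c1 * x by rewrite mulr_gt0.
have e0 : 0 < eta ^+ 2 by rewrite exprn_gt0.
have c0 : 0 < lam * x by rewrite mulr_gt0.
have rho01 : 0 <= rho1 <= 1 by lra.
have noiseP i := arru_noise_mean0 u0 ule mu y1p y2p rF1 rF2 mxi1 mxi2 mphi mU PU indU
  rho1 (c1 * x) delta (leq_addr i n) eta0.
have badP i := bbool (fun w => eta ^+ 2 < `|rho1h (n + i)%N w - rho1|) _ (mbad (n + i)%N) erefl.
have q0 : 0 <= b / (c1 * x) ^+ 2 * (eta^-1 + 2).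
  by rewrite mulr_ge0 ?divr_ge0 ?sqr_ge0// addr_ge0// invr_ge0 ltW.
(* Parameters: [L = c1 n]; [e = eta ^ 2], which makes the slope near [rho1] at most [e / eta = eta];
   and [lam n] as splitting level for the partial sums, whose second moments are at most
   [k n * (2 b) ^ 2]. *)
apply: le_trans (@Rintegral_increment_le _ T R P (k n) f _ _ _
  (fun j w => \sum_(i < j) C (n + i).+1 w) (eta / 2) (b / (c1 * x)) _ _ (c1 * x)^-1 (lam * x)
  (eps_y^-1 / x) eta ((k n)%:R * (2 * b) ^+ 2)
  bf bI (fun i => (noiseP i).1) (fun i => (badP i).1) _ _ q0 _ c0
  (fun w => arru_increment_le xi1 xi2 U rho1h rho2h delta n (k n) w
              u0 ule y1p y2p rho01 m21 eta0 e0 L0 c0)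
  _ (fun i => (noiseP i).2) _ _) _.
- by move=> j; apply: (@bounded_rv_sum _ _ _ j (fun i => C (n + i).+1)).
- by rewrite divr_ge0// ltW.
- by rewrite invr_ge0 ltW.
- by rewrite EI.
- by move=> i; rewrite (badP i).2; apply: hN2 => /=; rewrite (leq_trans n2)// leq_addr.
- by move=> j jk; apply: le_trans (sq n j) _; rewrite ler_wpM2r ?sqr_ge0// ler_nat.
have Bp : 0 <= (2 * b) ^+ 2 by exact: sqr_ge0.
apply: le_trans (increment_bound_le (eps_y^-1 / x) b0 c1p eta0 lam0 Bp x0 (ler0n _ (k n)) kK) _.
rewrite -/kb -/kl -/be.
have h1 : eta * kb <= eps / 4.
  have : eta * (1 + kb) = eps / 4 by rewrite /eta; field; rewrite gt_eqF//; lra.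
  lra.
have h2 : lam * kl <= eps / 4.
  have : lam * (1 + kl) = eps / 4 by rewrite /lam; field; rewrite gt_eqF//; lra.
  lra.
have h3 : (eps_y^-1 + be) / x <= eps / 2.
  by rewrite ler_pdivrMr// mulrC -ler_pdivrMr//; lra.
lra.
Unshelve. all: by end_near.
Qed.
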